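(* Let $K$ be an algebraically closed field of characteristic zero, and let $f:K[x,y]\to K[x,y]$ be a $K$-algebra endomorphism such that $\mathrm{Jac}(f(x),f(y))\in K^*$. Put $P=f(x)$, $Q=f(y)$, let $K[P,Q]$ be the $K$-subalgebra of $K[x,y]$ generated by $P,Q$, and let $K[P,Q][x+y]$ be the $K$-subalgebra of $K[x,y]$ generated by $P,Q,x+y$. Then the following three conditions are equivalent: (1) $K[P,Q][x+y]$ is a normal ring; (2) $K[x,y]$ is flat as a $K[P,Q][x+y]$-module; (3) $K[P,Q][x+y]$ is separable over $K[P,Q]$. Moreover, if one of these conditions is satisfied, then $f$ is invertible (an automorphism of $K[x,y]$).
   Context: A commutative ring is normal if its localizations at all prime ideals are integrally closed domains. A commutative $A$-algebra $B$ is separable over $A$ if $B$ is projective as a module over $B\otimes_A B$ via the multiplication map $B\otimes_A B\to B$. *)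

(* Defs.v *)
From HB Require Import structures.
From mathcomp Require Import all_boot all_order all_algebra.
From mathcomp Require Import fraction.
From mathcomp.multinomials Require Import mpoly.
Set Implicit Arguments. Unset Strict Implicit. Unset Printing Implicit Defensive.
Import Order.TTheory GRing.Theory Num.Theory.
Local Open Scope ring_scope.

Definition gen_subalg (K : fieldType) (n k : nat) (t : n.-tuple {mpoly K[k]})
  : {mpoly K[k]} -> Prop :=
  fun z => exists h : {mpoly K[n]}, z = comp_mpoly t h.

Definition jac2 (K : fieldType) (P Q : {mpoly K[2]}) : {mpoly K[2]} :=
  mderiv (0 : 'I_2) P * mderiv (1 : 'I_2) Q - mderiv (1 : 'I_2) P * mderiv (0 : 'I_2) Q.

Section Modules.
Variable R : comNzRingType.

(* A module over the subring S of R: an abelian group M with an action of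
   R whose restriction to S satisfies the module axioms. *)
Definition smodule (S : R -> Prop) (M : zmodType) (act : R -> M -> M) : Prop :=
  [/\ forall a m m', S a -> act a (m + m') = act a m + act a m',
      forall a b m, S a -> S b -> act (a + b) m = act a m + act b m,
      forall a b m, S a -> S b -> act (a * b) m = act a (act b m)
    & forall m, act 1 m = m].

(* ---------- Tensor product M (x)_S N, built as the free abelian group on
   M * N modulo the bilinearity / balancing relations. ---------- *)
Inductive tgen (M N : Type) :=
| TgL of M & M & N      (* (m+m') (x) n - m (x) n - m' (x) n *)
| TgR of M & N & N      (* m (x) (n+n') - m (x) n - m (x) n' *)
| TgB of R & M & N.     (* (a m) (x) n - m (x) (a n),  a in S *)

Definition tgen_ok (S : R -> Prop) (M N : Type) (g : tgen M N) : Prop :=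
  if g is TgB a _ _ then S a else True.

Definition tgen_exp (M N : zmodType) (actM : R -> M -> M) (actN : R -> N -> N)
  (g : tgen M N) : seq (int * (M * N)) :=
  match g with
  | TgL m m' n => [:: (1, (m + m', n)); (-1, (m, n)); (-1, (m', n))]
  | TgR m n n' => [:: (1, (m, n + n')); (-1, (m, n)); (-1, (m, n'))]
  | TgB a m n => [:: (1, (actM a m, n)); (-1, (m, actN a n))]
  end.

Definition fcoef (T : eqType) (l : seq (int * T)) (x : T) : int :=
  \sum_(t <- l | t.2 == x) t.1.

(* The element sum_i m_i (x) n_i of M (x)_S N is zero. *)
Fixpoint In_seq (T : Type) (x : T) (s : seq T) : Prop :=
  if s is y :: s' then y = x \/ In_seq x s' else False.

Definition tensor_zero (S : R -> Prop) (M N : zmodType)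
  (actM : R -> M -> M) (actN : R -> N -> N) (l : seq (M * N)) : Prop :=
  exists rs : seq (int * tgen M N),
    (forall kg, In_seq kg rs -> tgen_ok S kg.2) /\
    forall x, fcoef [seq ((1 : int), p) | p <- l] x =
              fcoef (flatten [seq [seq (kg.1 * t.1, t.2) | t <- tgen_exp actM actN kg.2]
                             | kg <- rs]) x.

Definition flat_over (S : R -> Prop) (N : zmodType) (actN : R -> N -> N) : Prop :=
  forall (M1 M2 : zmodType) (act1 : R -> M1 -> M1) (act2 : R -> M2 -> M2)
         (f : M1 -> M2),
    smodule S act1 -> smodule S act2 ->
    {morph f : x y / x + y} ->
    (forall a m, S a -> f (act1 a m) = act2 a (f m)) ->
    injective f ->
    forall l : seq (M1 * N),
      tensor_zero S act2 actN [seq (f p.1, p.2) | p <- l] ->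
      tensor_zero S act1 actN l.

(* ---------- Modules over B (x)_A B (A a subring of the subring B), given
   equivalently as abelian groups with two commuting B-actions (via b (x) 1
   and 1 (x) b) which agree on A. ---------- *)
Definition env_module (A B : R -> Prop) (M : zmodType) (l r : R -> M -> M) : Prop :=
  [/\ smodule B l, smodule B r,
      forall a b m, B a -> B b -> l a (r b m) = r b (l a m)
    & forall a m, A a -> l a m = r a m].

Definition env_hom (B : R -> Prop) (M N : zmodType) (lM rM : R -> M -> M)
  (lN rN : R -> N -> N) (g : M -> N) : Prop :=
  [/\ {morph g : x y / x + y},
      forall b m, B b -> g (lM b m) = lN b (g m)
    & forall b m, B b -> g (rM b m) = rN b (g m)].

(* B-(x)_A-B-linear maps from B (a module via the multiplication map
   B (x)_A B -> B, i.e. both actions are multiplication) to N. *)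
Definition env_hom_from_B (B : R -> Prop) (N : zmodType) (lN rN : R -> N -> N)
  (h : R -> N) : Prop :=
  [/\ forall b c, B b -> B c -> h (b + c) = h b + h c,
      forall b c, B b -> B c -> h (b * c) = lN b (h c)
    & forall b c, B b -> B c -> h (b * c) = rN b (h c)].

(* B is separable over A: B is a projective B (x)_A B-module via the
   multiplication map (lifting property along surjections). *)
Definition separable_over (A B : R -> Prop) : Prop :=
  forall (M N : zmodType) (lM rM : R -> M -> M) (lN rN : R -> N -> N)
         (g : M -> N) (h : R -> N),
    env_module A B lM rM -> env_module A B lN rN ->
    env_hom B lM rM lN rN g -> (forall y, exists x, g x = y) ->
    env_hom_from_B B lN rN h ->
    exists k : R -> M,
      env_hom_from_B B lM rM k /\ forall b, B b -> g (k b) = h b.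
End Modules.

Section Normal.
Variable R : idomainType.
Local Notation F := {fraction R}.

Definition prime_ideal (B p : R -> Prop) : Prop :=
  [/\ forall a, p a -> B a,
      p 0 /\ ~ p 1,
      forall a b, p a -> p b -> p (a + b),
      forall a b, B a -> p b -> p (a * b)
    & forall a b, B a -> B b -> p (a * b) -> p a \/ p b].

(* the localization B_p, realized inside the fraction field of R
   (B is a domain, being a subring of the domain R) *)
Definition localization (B p : R -> Prop) : F -> Prop :=
  fun z => exists a s, [/\ B a, B s, ~ p s & z = FracField.tofrac a / FracField.tofrac s].

Definition integrally_closed_domain (D : F -> Prop) : Prop :=
  forall z : F,
    (exists u v, [/\ D u, D v, v != 0 & z = u / v]) ->
    (exists q : {poly F}, [/\ q \is monic, forall i, D q`_i & root q z]) ->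
    D z.

Definition normal_ring (B : R -> Prop) : Prop :=
  forall p, prime_ideal B p -> integrally_closed_domain (localization B p).
End Normal.

(* Main.v *)
Require Import Defs.
From HB Require Import structures.
From mathcomp Require Import all_boot all_order all_algebra.
From mathcomp Require Import fraction boolp.
From mathcomp.multinomials Require Import mpoly.
From mathcomp Require Import ring zify.
Set Implicit Arguments. Unset Strict Implicit. Unset Printing Implicit Defensive.
Import GRing.Theory.
Local Open Scope ring_scope.

(** Each of the three conditions is equivalent to f being bijective, and the work lies in one
    direction.  Put w = x + y, so that K[x,y] = K[w][y], A = K[P,Q] and B = A[w].

    First, y lies in the fraction field of B (Formanek).  If M in B[T] has minimal degree among
    the polynomials killing y, its primitive part M0 over K[w][y] divides P(w,T) - P and
    Q(w,T) - Q, so M0'(y) divides the Jacobian and is a constant; by minimality M has degree one.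

    Next, each condition implies that at every point of the plane some G in A[T] with G(w) = 0
    has G'(w) nonzero, that is, B is unramified over A there.  Separability gives this directly,
    since otherwise d/dT at the point is a nonzero A-derivation of B.  Normality and flatness
    both provide a fraction y = b / c with b, c in B and c nonzero at the point; so d/dT would
    extend to a derivation of K[x,y] killing P and Q but not w, against the Jacobian condition.
    For flatness one tests a (x) 1 - b (x) y on the ideal aB + bB; for normality one uses the
    relation P(w,T) - P, whose coefficients lie in B and (for P or Q) do not all vanish.

    Finally, if B is unramified everywhere, the primitive minimal polynomial H of w over the
    factorial ring A has H'(w) without zeros, hence constant, so H has degree one and w is in A.
    Then y = a / b in lowest terms over A, and b T - a divides P(w,T) - P and Q(w,T) - Q, so b has
    no zeros and y is in A. *)

(** * Gcd domains and Gauss's lemma *)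

Lemma leq_pred_neq n j : (n.-1 <= j)%N -> j != n.-1 -> (n <= j)%N.
Proof. by lia. Qed.

Lemma polyZI (R : idomainType) (a : R) : a != 0 -> injective ( *:%R a : {poly R} -> {poly R}).
Proof. by move=> a0 p q; rewrite -!mul_polyC; apply: mulfI; rewrite polyC_eq0. Qed.

Section GcdDomain.
Variable R : idomainType.
Implicit Types (a b c d : R) (p : {poly R}).

Definition divides a b := exists q : R, b = q * a.

Definition cdivides a p := exists q : {poly R}, p = a *: q.

(** Only gcds are required, not factorisations: this suffices for Gauss's lemma and passes to
    polynomial rings. *)
Definition gcd_domain := forall a b, exists g : R,
  [/\ divides g a, divides g b & forall d, divides d a -> divides d b -> divides d g].

Definition coprime_elts a b := forall d, divides d a -> divides d b -> divides d 1.

Definition primitive p := forall d, cdivides d p -> divides d 1.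

Lemma divides_refl a : divides a a.
Proof. by exists 1; rewrite mul1r. Qed.

Lemma divides_trans a b c : divides a b -> divides b c -> divides a c.
Proof. by move=> [q ->] [r ->]; exists (r * q); rewrite mulrA. Qed.

Lemma divides_mull a b c : divides a b -> divides a (c * b).
Proof. by move=> [q ->]; exists (c * q); rewrite mulrA. Qed.

Lemma divides_mulr a b c : divides a b -> divides a (b * c).
Proof. by rewrite mulrC; apply: divides_mull. Qed.

Lemma divides0 a : divides a 0.
Proof. by exists 0; rewrite mul0r. Qed.

Lemma divides_addr a b c : divides a b -> divides a c -> divides a (b + c).
Proof. by move=> [q ->] [r ->]; exists (q + r); rewrite mulrDl. Qed.

Lemma divides_pmul2l c a b : c != 0 -> divides (c * a) (c * b) -> divides a b.
Proof.
move=> c0 [q e]; exists q; apply: (mulfI c0); rewrite e; ring.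
Qed.

Lemma cdividesP a p : cdivides a p <-> forall i, divides a p`_i.
Proof.
split=> [[q ->] i|]; first by rewrite coefZ mulrC; exists q`_i.
move=> /choice [h hE]; exists (\poly_(i < size p) h i); apply/polyP => i.
rewrite coefZ coef_poly; case: ltnP => [_|le]; first by rewrite hE mulrC.
by rewrite nth_default ?mulr0.
Qed.

Lemma cdivides_trans a b p : divides a b -> cdivides b p -> cdivides a p.
Proof. by move=> [q ->] [r ->]; exists (q *: r); rewrite scalerA mulrC. Qed.

Lemma cdividesD a p (q : {poly R}) : cdivides a p -> cdivides a q -> cdivides a (p + q).
Proof. by move=> [r ->] [s ->]; exists (r + s); rewrite scalerDr. Qed.

Lemma cdividesN a p : cdivides a p -> cdivides a (- p).
Proof. by move=> [r ->]; exists (- r); rewrite scalerN. Qed.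

Lemma cdividesMl a p (q : {poly R}) : cdivides a p -> cdivides a (q * p).
Proof. by move=> [r ->]; exists (q * r); rewrite scalerAr. Qed.

Lemma cdividesZ a b p : divides a b -> cdivides a (b *: p).
Proof. by move=> [q ->]; exists (q *: p); rewrite scalerA mulrC. Qed.

Hypothesis gcdR : gcd_domain.

(** The gcd of [c * a] and [c * b] is [h * c] with [h] dividing both [a] and [b], hence a unit;
    since [a] divides this gcd, it divides [c]. *)
Lemma euclid_lemma a b c : coprime_elts a b -> divides a (b * c) -> divides a c.
Proof.
have [->|c0] := eqVneq c 0; first by move=> _ _; apply: divides0.
move=> cop dvd; have [g [ga gb gmax]] := gcdR (c * a) (c * b).
have [h hE] : divides c g.
  by apply: gmax; apply: divides_mulr; apply: divides_refl.
have h1 : divides h 1.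
  by apply: cop; apply: (divides_pmul2l c0); rewrite [c * h]mulrC -hE.
have ag : divides a g.
  by apply: gmax; [apply/divides_mull/divides_refl | rewrite mulrC].
by apply: divides_trans ag _; rewrite hE; case: h1 => u e; exists u; rewrite mulrA -e mul1r.
Qed.

Lemma coprime_eltsX a b n : coprime_elts a b -> coprime_elts a (b ^+ n).
Proof.
move=> cop d da; elim: n => [|n IH]; first by rewrite expr0.
rewrite exprS => db; apply: IH; apply: (euclid_lemma (b := b)) db => e ed eb.
by apply: cop => //; apply: divides_trans da.
Qed.

Lemma reduced_fraction a b : b != 0 ->
  exists g a' b' : R, [/\ a = g * a', b = g * b', b' != 0 & coprime_elts b' a'].
Proof.
move=> b0; have [g [[a' aE] [b' bE] gmax]] := gcdR a b.
have [g0 b'0] : g != 0 /\ b' != 0.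
  by split; apply: contraNneq b0 => e; rewrite bE e ?mulr0 ?mul0r.
exists g, a', b'; split=> //; try by rewrite mulrC.
move=> d [r rE] [t tE]; apply: (divides_pmul2l g0); rewrite mulr1; apply: gmax.
  by exists t; rewrite aE tE; ring.
by exists r; rewrite bE rE; ring.
Qed.

Lemma content_exists p : exists c, cdivides c p /\ forall d, cdivides d p -> divides d c.
Proof.
elim/poly_ind: p => [|p a [c [cp cmax]]].
  exists 0; split; first by exists 0; rewrite scaler0.
  by move=> d _; apply: divides0.
have [g [gc ga gmax]] := gcdR c a; exists g; split.
  apply: cdividesD; first by rewrite mulrC; apply/cdividesMl/(cdivides_trans gc).
  by case: ga => q ->; exists q%:P; rewrite -mul_polyC -polyCM mulrC.
move=> d /cdividesP dvd; apply: gmax.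
  apply: cmax; apply/cdividesP => i; move: (dvd i.+1).
  by rewrite coefD coefMX coefC addr0.
by move: (dvd 0); rewrite coefD coefMX coefC add0r.
Qed.

Lemma size_sub_lead p : p != 0 -> (size (p - lead_coef p *: 'X^((size p).-1))%R < size p)%N.
Proof.
move=> p0; have sp : (0 < size p)%N by rewrite size_poly_gt0.
rewrite -[X in (_ < X)%N](prednK sp) ltnS; apply/leq_sizeP => j le.
rewrite coefB coefZ coefXn; have [->|ne] := eqVneq; first by rewrite mulr1 subrr.
by rewrite mulr0 subr0 nth_default //; apply: leq_pred_neq.
Qed.

Lemma primitive_part p : p != 0 -> exists c (q : {poly R}), [/\ p = c *: q, c != 0, q != 0 & primitive q].
Proof.
move=> p0; have [c [[q pE] cmax]] := content_exists p.
have [c0 q0] : c != 0 /\ q != 0.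
  by split; apply: contraNneq p0 => e; rewrite pE e ?scaler0 ?scale0r.
exists c, q; split=> // d [r qE]; apply: (divides_pmul2l c0); rewrite mulr1.
by apply: cmax; exists r; rewrite pE qE scalerA.
Qed.

(* Removing the leading term of one factor keeps the product divisible by gcd(a, lead),
   so by induction a is coprime to both leading coefficients, hence to their product. *)
Lemma gauss_coprime a p (q : {poly R}) :
  (forall d, divides d a -> cdivides d p -> divides d 1) ->
  (forall d, divides d a -> cdivides d q -> divides d 1) ->
  cdivides a (p * q) -> divides a 1.
Proof.
have [n] := ubnP (size p + size q); elim: n a p q => // n IH a p q le cp cq dvd.
have [p0|p0] := eqVneq p 0.
  by apply: cp; [apply: divides_refl | exists 0; rewrite p0 scaler0].
have [q0|q0] := eqVneq q 0.
  by apply: cq; [apply: divides_refl | exists 0; rewrite q0 scaler0].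
have lead_out (r s : {poly R}) : r != 0 -> (size r + size s < n.+1)%N ->
    (forall d, divides d a -> cdivides d r -> divides d 1) ->
    (forall d, divides d a -> cdivides d s -> divides d 1) ->
    cdivides a (r * s) -> coprime_elts a (lead_coef r).
  move=> r0 lt cr cs rs d da dl.
  set t := lead_coef r *: 'X^((size r).-1).
  have dt : cdivides d t by apply: cdividesZ.
  apply: (IH d (r - t) s); last 1 first.
  - rewrite mulrBl; apply: cdividesD; first exact: cdivides_trans rs.
    by apply: cdividesN; rewrite mulrC; apply: cdividesMl.
  - by rewrite ltnS in lt; apply: leq_trans lt; rewrite ltn_add2r; apply: size_sub_lead.
  - move=> e ed er; apply: cr; first exact: divides_trans da.
    by rewrite -(subrK t r); apply: cdividesD => //; apply: cdivides_trans dt.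
  - by move=> e ed es; apply: cs => //; apply: divides_trans da.
have ap := lead_out p q p0 le cp cq dvd.
have aq : coprime_elts a (lead_coef q).
  by apply: (lead_out q p) => //; rewrite 1?addnC 1?mulrC.
apply: aq; first exact: divides_refl.
apply: (euclid_lemma ap); rewrite -lead_coefM /lead_coef.
by move/cdividesP: dvd; apply.
Qed.

Lemma gauss_lemma a p (q : {poly R}) : a != 0 -> primitive q -> cdivides a (p * q) -> cdivides a p.
Proof.
move=> a0 prq [r rE].
(* The content of [p * 'X + a%:P] is the gcd of [a] and the coefficients of [p]. Dividing it out
   leaves [a'] coprime to [p'], and [gauss_coprime] makes [a'] a unit. *)
have [c [cpa cmax]] := content_exists (p * 'X + a%:P).
have [ca [p' pE]] : divides c a /\ cdivides c p.
  move/cdividesP: cpa => dvd; split; first by move: (dvd 0); rewrite coefD coefMX coefC add0r.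
  by apply/cdividesP => i; move: (dvd i.+1); rewrite coefD coefMX coefC addr0.
case: ca => a' aE; have [c0 a'0] : c != 0 /\ a' != 0.
  by split; apply: contraNneq a0 => e; rewrite aE e ?mulr0 ?mul0r.
have [u uE] : divides a' 1.
  apply: (@gauss_coprime a' p' q).
  - move=> d da [s sE]; apply: (divides_pmul2l c0); rewrite mulr1; apply: cmax.
    case: da => t tE; exists (s * 'X + t%:P).
    rewrite pE sE aE tE -!mul_polyC !polyCM; ring.
  - by move=> d _; apply: prq.
  - exists r; apply: (polyZI c0); rewrite scalerAl -pE rE aE scalerA mulrC //.
by exists (u *: p'); rewrite pE aE scalerA; congr (_ *: _); rewrite mulrAC [a' * _]mulrC -uE mul1r.
Qed.

(** Divisibility over the fraction field descends to [R]: primitivity of [q] forces [a] to divide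
    [r]. *)
Lemma primitive_divides a p (q r : {poly R}) : a != 0 -> primitive q -> a *: p = r * q ->
  exists s, p = s * q.
Proof.
move=> a0 prq e; have [s sE] : cdivides a r.
  by apply: (gauss_lemma a0 prq); exists p.
by exists s; apply: (polyZI a0); rewrite e sE scalerAl.
Qed.

End GcdDomain.

Lemma gcd_domain_field (F : fieldType) : gcd_domain F.
Proof.
move=> a b; have [a0|a0] := eqVneq a 0; first (have [b0|b0] := eqVneq b 0).
- by exists 0; rewrite a0 b0; split=> //; exists 0; rewrite mul0r.
- by exists b; split=> //; [exists 0; rewrite a0 mul0r | exists 1; rewrite mul1r].
exists 1; split; try by [exists a; rewrite mulr1 | exists b; rewrite mulr1].
move=> d [q e] _; exists d^-1; rewrite mulVf //.
by apply: contraNneq a0 => d0; rewrite e d0 mulr0.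
Qed.

(** The gcd is the gcd of the contents times the primitive part of [gcdp], the gcd up to scalars. *)
Lemma gcd_domain_poly (R : idomainType) : gcd_domain R -> gcd_domain {poly R}.
Proof.
move=> gcdR p q.
have [->|p0] := eqVneq p 0.
  exists q; split; [exact: divides0 | exact: divides_refl | by []].
have [->|q0] := eqVneq q 0.
  exists p; split; [exact: divides_refl | exact: divides0 | by []].
have [c [p' [pE c0 p'0 prp]]] := primitive_part gcdR p0.
have [e [q' [qE e0 q'0 prq]]] := primitive_part gcdR q0.
have [k [[k1 cE] [k2 eE] kmax]] := gcdR c e.
have g0 : gcdp p' q' != 0 by rewrite gcdp_eq0 negb_and p'0.
have [l [g [gE l0 _ prg]]] := primitive_part gcdR g0.
(* Over a domain [%|] means divisibility up to a nonzero scalar; primitivity of [g] removes the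
   scalar. *)
have dvdg (r : {poly R}) : gcdp p' q' %| r -> exists s, r = s * g.
  case/Pdiv.Idomain.dvdpP => -[a u] /= a0; rewrite gE => aE.
  by apply: (primitive_divides gcdR a0 prg (r := l *: u)); rewrite aE -scalerAr scalerAl.
have [p1 p1E] := dvdg p' (dvdp_gcdl _ _).
have [q1 q1E] := dvdg q' (dvdp_gcdr _ _).
(* If [m *: d] divides [b *: r'] with [d] and [r'] primitive, then contents and primitive parts
   divide separately. *)
have factor (d r r' s : {poly R}) (m b : R) : primitive r' -> primitive d -> b != 0 -> m != 0 ->
    r = b *: r' -> r = s * (m *: d) -> divides m b /\ exists t, r' = t * d.
  move=> prr prd b0 m0 rE rdE; split.
    have : cdivides m b%:P.
      apply: (gauss_lemma gcdR m0 prr); exists (s * d).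
      by rewrite mul_polyC -rE rdE -scalerAr.
    by move/cdividesP => /(_ 0); rewrite coefC.
  apply: (primitive_divides gcdR b0 prd (r := m *: s)).
  by rewrite -rE rdE -scalerAr scalerAl.
exists (k *: g); split.
- by exists (k1 *: p1); rewrite pE p1E cE -!mul_polyC !polyCM; ring.
- by exists (k2 *: q1); rewrite qE q1E eE -!mul_polyC !polyCM; ring.
move=> d [u uE] [v vE].
have d0 : d != 0 by apply: contraNneq p0 => d0; rewrite uE d0 mulr0.
have [m [d' [dE m0 d'0 prd]]] := primitive_part gcdR d0; rewrite dE in uE vE.
have [mc [s sE]] := factor _ _ _ _ _ _ prp prd c0 m0 pE uE.
have [me [t tE]] := factor _ _ _ _ _ _ prq prd e0 m0 qE vE.
have [k' k'E] := kmax _ mc me.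
have : d' %| gcdp p' q' by rewrite dvdp_gcd sE tE !dvdp_mulIr.
case/Pdiv.Idomain.dvdpP => -[a w] /= a0; rewrite gE scalerA => aE.
have [g' g'E] := primitive_divides gcdR (mulf_neq0 a0 l0) prd aE.
by exists (k' *: g'); rewrite dE k'E g'E -!mul_polyC !polyCM; ring.
Qed.

(* [V] is typically the polynomials over a subring that vanish at a given point. *)
Lemma minimal_pseudo_divides (R : idomainType) (V : {poly R} -> Prop) (m : {poly R}) :
  (forall p k, V p -> V (lead_coef m *: p - lead_coef p *: ('X^k * m))) ->
  m != 0 -> (forall p, V p -> (size p < size m)%N -> p = 0) ->
  forall p, V p -> exists a u, a != 0 /\ a *: p = u * m.
Proof.
move=> Vsub m0 mmin p; have [n] := ubnP (size p); elim: n p => // n IH p le Vp.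
have [lt|ge] := ltnP (size p) (size m).
  by exists 1, 0; rewrite oner_eq0 mul0r (mmin p Vp lt) scaler0.
have [->|p0] := eqVneq p 0; first by exists 1, 0; rewrite oner_eq0 mul0r scaler0.
set k := (size p - size m)%N.
have lm0 : lead_coef m != 0 by rewrite lead_coef_eq0.
have [|a [u [a0 aE]]] := IH _ _ (Vsub p k Vp).
  have sp : (0 < size p)%N by rewrite size_poly_gt0.
  rewrite ltnS in le; apply: leq_trans le; rewrite -[X in (_ < X)%N](prednK sp) ltnS.
  apply/leq_sizeP => j lej; rewrite coefB !coefZ coefXnM.
  have [->|ne] := eqVneq j (size p).-1.
    have sm : (0 < size m)%N by rewrite size_poly_gt0.
    have -> : ((size p).-1 < k)%N = false by rewrite /k; lia.
    have -> : ((size p).-1 - k = (size m).-1)%N by rewrite /k; lia.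
    by rewrite /lead_coef mulrC subrr.
  have lepj := leq_pred_neq lej ne; rewrite [p`_j]nth_default //.
  case: ifP => _; first by rewrite !mulr0 subrr.
  rewrite [m`__]nth_default ?mulr0 ?subrr // /k.
  have leq_subsub a b c : (a <= b)%N -> (b <= c)%N -> (a <= c - (b - a))%N by lia.
  exact: leq_subsub.
exists (a * lead_coef m), (u + (a * lead_coef p) *: 'X^k); split; first by rewrite mulf_neq0.
by move: aE; rewrite mulrDl -!mul_polyC !polyCM => <-; ring.
Qed.

Lemma exists_minimal_size (R : nzRingType) (V : {poly R} -> Prop) :
  (exists p, V p /\ p != 0) ->
  exists m, [/\ V m, m != 0 & forall p, V p -> (size p < size m)%N -> p = 0].
Proof.
move=> [p [Vp p0]]; have [n] := ubnP (size p); elim: n p Vp p0 => // n IH p Vp p0 le.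
have [[q [Vq q0 lt]]|no] := pselect (exists q, [/\ V q, q != 0 & (size q < size p)%N]).
  by apply: (IH q) => //; apply: leq_trans lt _.
exists p; split=> // q Vq lt; apply/eqP; apply: contraT => q0.
by case: no; exists q.
Qed.

(** * Keller maps in the coordinates w, y *)

(* {poly {poly K}} is read as K[w][y]: the inner variable is w, the outer one y. *)
Definition evp (K : comNzRingType) (w0 y0 : K) : {poly {poly K}} -> K :=
  horner_eval w0 \o horner_eval y0%:P.
HB.instance Definition _ (K : comNzRingType) (w0 y0 : K) := GRing.RMorphism.on (evp w0 y0).

Lemma evpE (K : comNzRingType) (w0 y0 : K) d :
  evp w0 y0 d = (map_poly (horner_eval w0) d).[y0].
Proof.
rewrite /evp /= /horner_eval -[X in _ = _.[X]](hornerC y0 w0).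
exact: (esym (horner_map (horner_eval w0) d y0%:P)).
Qed.

Lemma evpC (K : comNzRingType) (w0 y0 c : K) : evp w0 y0 c%:P%:P = c.
Proof. by rewrite /evp /= /horner_eval !hornerC. Qed.

Lemma evpD (K : comNzRingType) (w0 y0 : K) d e : evp w0 y0 (d + e) = evp w0 y0 d + evp w0 y0 e.
Proof. by rewrite /evp /= /horner_eval !hornerD. Qed.
Lemma evpB (K : comNzRingType) (w0 y0 : K) d e : evp w0 y0 (d - e) = evp w0 y0 d - evp w0 y0 e.
Proof. by rewrite /evp /= /horner_eval !(hornerD, hornerN). Qed.
Lemma evpM (K : comNzRingType) (w0 y0 : K) d e : evp w0 y0 (d * e) = evp w0 y0 d * evp w0 y0 e.
Proof. exact: rmorphM. Qed.

Lemma evpXn (K : comNzRingType) (w0 y0 : K) d n : evp w0 y0 (d ^+ n) = evp w0 y0 d ^+ n.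
Proof. by rewrite /evp /= /horner_eval !horner_exp. Qed.

(** As y is the outer variable, this is the partial derivative in w, while [deriv] on K[w][y] is the
    one in y. *)
Definition dw (K : nzRingType) : {poly {poly K}} -> {poly {poly K}} := map_poly (@deriv K).
HB.instance Definition _ (K : nzRingType) := GRing.Additive.on (@dw K).

Lemma dwM (K : comNzRingType) (p q : {poly {poly K}}) : dw (p * q) = dw p * q + p * dw q.
Proof.
apply/polyP => i; rewrite coefD !coefM coef_map /= coefM raddf_sum /= -big_split /=.
by apply: eq_bigr => j _; rewrite derivM !coef_map.
Qed.

Lemma dwC (K : nzRingType) (p : {poly K}) : dw p%:P = p^`()%:P.
Proof. exact: map_polyC. Qed.

Lemma dwX (K : nzRingType) : dw ('X : {poly {poly K}}) = 0.
Proof.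
apply/polyP => i; rewrite coef_map coefX coef0 /=.
by case: (i == 1)%N; rewrite /= ?derivC ?deriv0.
Qed.

Lemma dwMX (K : comNzRingType) (p : {poly {poly K}}) : dw (p * 'X) = dw p * 'X.
Proof. by rewrite dwM dwX mulr0 addr0. Qed.

Lemma closed_no_root (K : closedFieldType) (p : {poly K}) :
  (forall x, p.[x] != 0) -> exists c, c != 0 /\ p = c%:P.
Proof.
move=> nz; have sp : size p == 1%N.
  by apply: contraT => /closed_rootP [x]; rewrite /root (negPf (nz x)).
have pE : p = (p`_0)%:P by apply: size1_polyC; rewrite (eqP sp).
by exists p`_0; split=> //; move: (nz 0); rewrite pE hornerC coefC.
Qed.

Lemma closed_all_root (K : closedFieldType) (p : {poly K}) :
  (forall x, p.[x] = 0) -> p = 0.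
Proof.
move=> z; have [x|c [_ pE]] := @closed_no_root K (p + 1).
  by rewrite hornerD z add0r hornerC oner_eq0.
have pC : p = (c - 1)%:P by rewrite polyCB -pE addrK.
by move: (z 0); rewrite pC hornerC => ->.
Qed.

(** For each [w0] the polynomial in y has no root, hence is constant; so its higher coefficients
    vanish at every [w0]. What remains is a polynomial in w without roots. *)
Lemma nonvanishing_const (K : closedFieldType) (d : {poly {poly K}}) :
  (forall w0 y0, evp w0 y0 d != 0) -> exists c, c != 0 /\ d = c%:P%:P.
Proof.
move=> nz; have d0 : d = (d`_0)%:P.
  apply/polyP => -[|i]; rewrite coefC //=; apply: closed_all_root => w0.
  have [y0|c [_ /polyP /(_ i.+1)]] := @closed_no_root K (map_poly (horner_eval w0) d).
    by rewrite -evpE.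
  by rewrite coef_map coefC.
have [w0|c [c0 dc]] := @closed_no_root K d`_0.
  by move: (nz w0 0); rewrite {1}d0 /evp /= /horner_eval hornerC.
by exists c; rewrite c0 d0 dc.
Qed.

(** * The algebras A and A[w] for a pair P, Q with constant Jacobian *)

Section Core.
Variables (K : closedFieldType) (hK : [pchar K] =i pred0).
Local Notation D := {poly {poly K}}.
Local Notation w := ('X%:P : D).
Local Notation y := ('X : D).
Variables (S : idomainType) (gcdS : gcd_domain S) (phi : {rmorphism S -> D}).
Hypothesis phi_inj : injective phi.
Variables (kap : {rmorphism K -> S}).
Hypothesis phi_kap : forall c, phi (kap c) = c%:P%:P.
Variables (sP sQ : S) (jc : K).
Hypothesis jc0 : jc != 0.
Local Notation P := (phi sP).
Local Notation Q := (phi sQ).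
Hypothesis jacPQ : dw P * Q^`() - P^`() * dw Q = jc%:P%:P.

Lemma natK0 n : n.+1%:R != 0 :> K.
Proof. by move/pcharf0P: hK => ->. Qed.

Lemma mulrSn_eq0 (d : D) n : d *+ n.+1 = 0 -> d = 0.
Proof.
rewrite -[d *+ _]mulr_natl => /eqP; rewrite mulf_eq0 => /orP [|/eqP //].
have -> : n.+1%:R = (n.+1%:R : K)%:P%:P :> D by rewrite !rmorph_nat.
by rewrite !polyC_eq0 (negPf (natK0 n)).
Qed.

Lemma D_unit (d e : D) (c : K) : c != 0 -> d * e = c%:P%:P -> exists c', c' != 0 /\ d = c'%:P%:P.
Proof.
move=> c0 de; apply: nonvanishing_const => w0 y0.
have : evp w0 y0 (d * e) != 0 by rewrite de evpC.
by rewrite rmorphM mulf_eq0 negb_or => /andP [].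
Qed.

(** At z = w the values form B; the kernels at z = w and z = y are the relations of w and y over
    A. *)
Definition hor (z : D) (G : {poly S}) : D := (map_poly phi G).[z].
Local Notation horw := (hor w).
(* B = A[w], where A is the image of phi. *)
Definition memB (d : D) := exists G, d = horw G.

Lemma horD z G G' : hor z (G + G') = hor z G + hor z G'.
Proof. by rewrite /hor rmorphD hornerD. Qed.
Lemma horN z G : hor z (- G) = - hor z G.
Proof. by rewrite /hor rmorphN hornerN. Qed.
Lemma horM z G G' : hor z (G * G') = hor z G * hor z G'.
Proof. by rewrite /hor rmorphM hornerM. Qed.
Lemma horC z s : hor z s%:P = phi s.
Proof. by rewrite /hor map_polyC hornerC. Qed.
Lemma horX z : hor z 'X = z.
Proof. by rewrite /hor map_polyX hornerX. Qed.
Lemma hor0 z : hor z 0 = 0.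
Proof. by rewrite /hor rmorph0 horner0. Qed.
Lemma hor1 z : hor z 1 = 1.
Proof. by rewrite /hor rmorph1 hornerC. Qed.
Lemma horXn z G n : hor z (G ^+ n) = hor z G ^+ n.
Proof. by elim: n => [|n IH]; rewrite ?expr0 ?hor1 // !exprS horM IH. Qed.
Lemma hor_nat z n : hor z n%:R = n%:R.
Proof. by rewrite -(rmorph_nat (@polyC S)) horC rmorph_nat. Qed.

Lemma memBD d e : memB d -> memB e -> memB (d + e).
Proof. by move=> [G ->] [H ->]; exists (G + H); rewrite horD. Qed.
Lemma memBN d : memB d -> memB (- d).
Proof. by move=> [G ->]; exists (- G); rewrite horN. Qed.
Lemma memBM d e : memB d -> memB e -> memB (d * e).
Proof. by move=> [G ->] [H ->]; exists (G * H); rewrite horM. Qed.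
Lemma memB_phi s : memB (phi s).
Proof. by exists s%:P; rewrite horC. Qed.
Lemma memB_K (c : K) : memB c%:P%:P.
Proof. by rewrite -phi_kap; apply: memB_phi. Qed.
Lemma memB0 : memB 0. Proof. by rewrite -(rmorph0 phi); apply: memB_phi. Qed.
Lemma memBw (q : {poly K}) : memB q%:P.
Proof.
elim/poly_ind: q => [|q c IH]; first exact: memB0.
by rewrite polyCD polyCM; apply/memBD/memB_K; apply: memBM => //; exists 'X; rewrite horX.
Qed.

Lemma memB_nat n : memB n%:R.
Proof. by rewrite -(rmorph_nat (@polyC {poly K})); apply: memBw. Qed.

(** This is p(w,T) - p(w,y) as a polynomial in T: [^:P] embeds the coefficients of [p], which lie in
    K[w], as constants in y. *)
Definition fiber_poly (p : D) : {poly D} := p^:P - p%:P.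

Lemma fiber_poly_root p : (fiber_poly p).[y] = 0.
Proof. by rewrite hornerD hornerN hornerC -/(p \Po 'X) comp_polyXr subrr. Qed.

Lemma fiber_poly_deriv p : (fiber_poly p)^`().[y] = p^`().
Proof. by rewrite derivB derivC subr0 deriv_map -/(_ \Po 'X) comp_polyXr. Qed.

Lemma fiber_poly_memB s i : memB (fiber_poly (phi s))`_i.
Proof.
rewrite coefB coef_map coefC; apply: memBD; first exact: memBw.
by apply: memBN; case: ifP => _; [apply: memB_phi | apply: memB0].
Qed.

(** If all coefficients of both polynomials vanished at the point, so would their T-derivatives at T
    = y, which are the y-derivatives of P and Q, and with them the Jacobian. *)
Lemma fiber_poly_nonvanishing w0 y0 :
  (exists i, evp w0 y0 (fiber_poly P)`_i != 0) \/ (exists i, evp w0 y0 (fiber_poly Q)`_i != 0).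
Proof.
apply: contrapT => no.
have z p : ~ (exists i, evp w0 y0 (fiber_poly p)`_i != 0) -> evp w0 y0 p^`() = 0.
  move=> np; have z i : evp w0 y0 (fiber_poly p)`_i = 0.
    by apply/eqP; apply: contraT => ?; case: np; exists i.
  rewrite -fiber_poly_deriv -horner_map -deriv_map /=.
  have -> : map_poly (evp w0 y0) (fiber_poly p) = 0.
    by apply/polyP => i; rewrite coef_map coef0; apply: z.
  by rewrite deriv0 horner0.
have zP : evp w0 y0 P^`() = 0 by apply: z => h; apply: no; left.
have zQ : evp w0 y0 Q^`() = 0 by apply: z => h; apply: no; right.
have e : evp w0 y0 (dw P * Q^`() - P^`() * dw Q)
    = evp w0 y0 (dw P) * evp w0 y0 Q^`() - evp w0 y0 P^`() * evp w0 y0 (dw Q).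
  by rewrite evpB !evpM.
by move: jc0; rewrite -(evpC w0 y0 jc) -jacPQ e zP zQ mulr0 mul0r subrr eqxx.
Qed.

Lemma size_deriv_le2 (M : {poly D}) : (size M^`() <= 1)%N -> (size M <= 2)%N.
Proof.
move/leq_sizeP => z; apply/leq_sizeP => -[|[|j]] // _.
by move: (z j.+1 isT); rewrite coef_deriv; apply: mulrSn_eq0.
Qed.

Lemma formanek : exists a b, [/\ memB a, memB b, b != 0 & b * y = a].
Proof.
pose V (G : {poly D}) := (forall i, memB G`_i) /\ G.[y] = 0.
have Vfib s : V (fiber_poly (phi s)).
  by split; [move=> i; apply: fiber_poly_memB | apply: fiber_poly_root].
have gcdD : gcd_domain D := gcd_domain_poly (gcd_domain_poly (@gcd_domain_field K)).
have [s0 s0nz] : exists s, fiber_poly (phi s) != 0.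
  have [[i nz]|[i nz]] := fiber_poly_nonvanishing 0 0; [exists sP|exists sQ];
  by apply: contraNneq nz => ->; rewrite coef0 rmorph0.
have [|M [[MB My] M0 Mmin]] := @exists_minimal_size D V; first by exists (fiber_poly (phi s0)).
(* [M'] is the primitive part of [M], not its derivative. *)
have [mu [M' [ME mu0 M'0 prM]]] := primitive_part gcdD M0.
have Mdvd G : V G -> exists U, G = U * M'.
  move=> VG; have [|a [U [a0 aE]]] := minimal_pseudo_divides _ M0 Mmin VG.
    move=> p k [pB py]; split=> [i|].
      rewrite coefB !coefZ coefXnM; apply: memBD; first by apply: memBM; rewrite // /lead_coef.
      apply/memBN/memBM; first by rewrite /lead_coef.
      by case: ifP => _; [apply: memB0 | ].
    by rewrite hornerD hornerN !hornerZ hornerM py My !mulr0 subrr.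
  apply: (primitive_divides gcdD a0 prM (r := mu *: U)).
  by rewrite aE ME -scalerAr scalerAl.
(* Differentiate p(w,T) - p(w,y) = U M' in T and put T = y: the term with M'(y) = 0 drops out. *)
have Mder s : divides (M'^`().[y]) (phi s)^`().
  have [U UE] := Mdvd _ (Vfib s); exists U.[y].
  rewrite -fiber_poly_deriv UE derivM hornerD !hornerM.
  suff -> : M'.[y] = 0 by ring.
  by move/eqP: My; rewrite ME hornerZ mulf_eq0 (negPf mu0) => /eqP.
have [c0 [c0nz c0E]] : exists c', c' != 0 /\ M'^`().[y] = c'%:P%:P.
  have [[u uE] [v vE]] := (Mder sP, Mder sQ).
  apply: (@D_unit _ (dw P * v - u * dw Q) jc) => //.
  rewrite -jacPQ uE vE; ring.
(* The leading coefficient of p(w,T) - p(w,y) depends on w alone, so its factor [lead_coef M'] does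
   too; this puts the latter in B. *)
have [l lE] : exists l : {poly K}, lead_coef M' = l%:P.
  have [U UE] := Mdvd _ (Vfib s0).
  have /(congr1 (fun q : D => size q)) : lead_coef (fiber_poly (phi s0)) = lead_coef U * lead_coef M'.
    by rewrite UE lead_coefM.
  have -> : size (lead_coef (fiber_poly (phi s0))) = 1%N.
    set p := phi s0 in s0nz *.
    have sp : (1 < size p)%N.
      rewrite ltnNge; apply: contra s0nz => /size1_polyC ->.
      by rewrite /fiber_poly map_polyC subrr.
    have -> : lead_coef (fiber_poly p) = (lead_coef p)%:P.
      rewrite lead_coefDl.
        by rewrite lead_coef_map_inj //; apply: polyC_inj.
      rewrite size_polyN size_map_inj_poly //; last exact: polyC_inj.
      by rewrite size_polyC; apply: leq_ltn_trans sp; case: (_ != 0).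
    by rewrite size_polyC lead_coef_eq0 -size_poly_gt0 (ltnW sp).
  have M'l : lead_coef M' != 0 by rewrite lead_coef_eq0.
  have Ul : lead_coef U != 0.
    by apply: contraNneq s0nz => /eqP; rewrite lead_coef_eq0 UE => /eqP ->; rewrite mul0r.
  move=> e; exists (lead_coef M')`_0; apply: size1_polyC; move: e.
  rewrite size_mul //; move: M'l Ul; rewrite -!size_poly_gt0; lia.
(* Both terms take the same value at y because [lead_coef M] is [mu] times [l]. So [G] is a relation
   over B of lower degree than [M] and vanishes, which makes the derivative of [M] constant in T. *)
pose G := l%:P *: M^`() - (lead_coef M * c0%:P%:P)%:P.
have G0 : G = 0.
  apply: Mmin.
    split=> [i|].
      rewrite coefB coefZ coef_deriv coefC; apply: memBD.
        apply: memBM; first exact: memBw.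
        by rewrite -mulr_natr; apply: memBM => //; apply: memB_nat.
      apply: memBN; case: ifP => _; last exact: memB0.
      by apply/memBM/memB_K; rewrite /lead_coef.
    rewrite /G hornerD hornerN hornerZ hornerC ME derivZ hornerZ c0E.
    by rewrite lead_coefZ lE; ring.
  have sM : (1 < size M)%N.
    rewrite ltnNge; apply: contra M0 => /size1_polyC Mc.
    by move: My; rewrite Mc hornerC => ->.
  rewrite (leq_ltn_trans (size_polyD _ _)) // gtn_max size_polyN size_polyC.
  rewrite (leq_ltn_trans (size_scale_leq _ _)) ?lt_size_deriv //=.
  by apply: leq_ltn_trans sM; case: (_ != 0).
have sM2 : (size M <= 2)%N.
  apply: size_deriv_le2; have l0 : l%:P != 0 :> D by rewrite -lE lead_coef_eq0.
  move/eqP: G0; rewrite subr_eq0 => /eqP e.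
  have <- : size (l%:P *: M^`()) = size M^`() by rewrite -mul_polyC size_Cmul.
  by rewrite e size_polyC; case: (_ != 0).
exists (- M`_0), M`_1; split=> //; first exact: memBN.
  apply: contraNneq M0 => M1; have Mc : M = (M`_0)%:P.
    apply/polyP => -[|[|j]]; rewrite coefC //=.
    by rewrite nth_default //; apply: leq_trans sM2 _.
  by move: My; rewrite Mc hornerC => ->.
have ME1 : M = M`_1 *: 'X + (M`_0)%:P.
  apply/polyP => -[|[|j]]; rewrite coefD coefZ coefX coefC /= ?mulr0 ?mulr1 ?add0r ?addr0 //.
  by rewrite nth_default //; apply: leq_trans sM2 _.
by move/eqP: My; rewrite {1}ME1 hornerD hornerZ hornerX hornerC addr_eq0 => /eqP.
Qed.

(* The minimal polynomial H of w over A is primitive and generates the kernel of A[T] -> D, so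
   H'(w) has no zeros, hence is a constant c; then H' - c vanishes at w and H has degree one. *)
Lemma unramified_w :
  (forall w0 y0, exists G, horw G = 0 /\ evp w0 y0 (horw G^`()) != 0) ->
  exists s, phi s = w.
Proof.
move=> unr; pose V (G : {poly S}) := horw G = 0.
have [|H [VH H0 Hmin]] := @exists_minimal_size S V.
  have [G [VG nz]] := unr 0 0; exists G; split=> //.
  by apply: contraNneq nz => ->; rewrite deriv0 hor0 /evp /= /horner_eval !horner0.
have [mu [H1 [HE mu0 H10 prH]]] := primitive_part gcdS H0.
have phi0 s : (phi s == 0) = (s == 0) by rewrite -(rmorph0 phi) (inj_eq phi_inj).
have H1w : horw H1 = 0.
  by move/eqP: VH; rewrite /V HE -mul_polyC horM horC mulf_eq0 phi0 (negPf mu0) => /eqP.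
have sH1 : size H1 = size H by rewrite HE -mul_polyC size_Cmul.
have Hdvd G : V G -> exists U, G = U * H1.
  move=> VG; have [|a [U [a0 aE]]] := minimal_pseudo_divides _ H0 Hmin VG.
    by move=> p k Vp; rewrite /V -!mul_polyC horD horN !horM Vp VH !mulr0 subrr.
  apply: (primitive_divides gcdS a0 prH (r := mu *: U)).
  by rewrite aE HE -scalerAr scalerAl.
have [c [c0 cE]] : exists c, c != 0 /\ horw H1^`() = c%:P%:P.
  apply: nonvanishing_const => w0 y0; have [G [VG nz]] := unr w0 y0.
  have [U UE] := Hdvd G VG; move: nz; rewrite UE derivM horD !horM H1w mulr0 add0r evpM.
  by rewrite mulf_eq0 negb_or => /andP [].
have sH : (1 < size H)%N.
  rewrite ltnNge; apply: contra H0 => /size1_polyC Hc.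
  by move/eqP: VH; rewrite /V Hc horC phi0 polyC_eq0.
have /eqP : H1^`() - (kap c)%:P = 0.
  apply: Hmin; first by rewrite /V horD horN horC phi_kap cE subrr.
  rewrite (leq_ltn_trans (size_polyD _ _)) // gtn_max size_polyN size_polyC.
  rewrite -sH1 lt_size_deriv ?sH1 //=.
  by apply: leq_ltn_trans sH; case: (_ != 0).
rewrite subr_eq0 => /eqP dH1.
have H1E : H1 = kap c *: 'X + (H1`_0)%:P.
  apply/polyP => -[|j]; rewrite coefD coefZ coefX coefC /= ?mulr0 ?add0r // addr0.
  apply: phi_inj; move: (congr1 (fun G : {poly S} => phi G`_j) dH1); rewrite coef_deriv coefC.
  case: j => [|j]; first by rewrite mulr1n mulr1.
  by rewrite rmorphMn mulr0 rmorph0; apply: mulrSn_eq0.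
(* The root of the linear polynomial [H1], whose leading coefficient is the constant [c]. *)
exists (- (H1`_0) * kap c^-1).
rewrite rmorphM rmorphN phi_kap; move/eqP: H1w.
rewrite {1}H1E -mul_polyC horD horM !horC horX phi_kap addr_eq0 => /eqP <-.
by rewrite mulrAC -!rmorphM mulfV // !rmorph1 mul1r.
Qed.

(* Writing y = a / b in lowest terms over A, the primitive polynomial b T - a divides the
   fibre polynomials of P and Q over A, which do not vanish at any point; so neither does b. *)
Lemma y_in_image : (exists s, phi s = w) -> exists s, phi s = y.
Proof.
move=> [sw swE].
have memB_im d : memB d -> exists s, phi s = d.
  move=> [G ->]; exists G.[sw]; rewrite /hor -swE; exact: esym (horner_map phi G sw).
have phi0 s : (phi s == 0) = (s == 0) by rewrite -(rmorph0 phi) (inj_eq phi_inj).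
have [a [b [/memB_im [sa <-] /memB_im [sb <-]]]] := formanek; rewrite phi0 => sb0.
have [g [a' [b' [aE bE b'0 cop]]]] := reduced_fraction gcdS sa sb0.
rewrite aE bE !rmorphM -mulrA => /(mulfI _) e.
have {e} yE : phi b' * y = phi a'.
  by apply: e; rewrite phi0; apply: contraNneq sb0 => g0; rewrite bE g0 mul0r.
pose L := b' *: 'X - a'%:P.
have L1 : L`_1 = b' by rewrite coefB coefZ coefX coefC mulr1 subr0.
have L0 : L`_0 = - a' by rewrite coefB coefZ coefX coefC mulr0 sub0r.
have Lnz : L != 0 by apply: contraNneq b'0 => L00; rewrite -L1 L00 coef0.
have sL : (size L <= 2)%N.
  by apply/leq_sizeP => -[|[|j]] // _; rewrite coefB coefZ coefX coefC mulr0 subr0.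
have prL : primitive L.
  move=> d /cdividesP dvd; apply: cop; first by rewrite -L1.
  by have := divides_mull (-1) (dvd 0); rewrite L0 mulN1r opprK.
pose V (G : {poly S}) := hor y G = 0.
have VL : V L by rewrite /V /L -mul_polyC horD horN horM !horC horX yE subrr.
have Ldvd G : V G -> exists U, G = U * L.
  move=> VG; have [p k Vp||a0 [U [a00 UE]]] := minimal_pseudo_divides _ Lnz _ VG.
  - by rewrite /V -!mul_polyC horD horN !horM Vp VL !mulr0 subrr.
  - move=> p Vp lt; have sp : (size p <= 1)%N by rewrite -ltnS; apply: leq_trans lt sL.
    by move: Vp; rewrite /V (size1_polyC sp) horC => /eqP; rewrite phi0 => /eqP ->.
  - exact: (primitive_divides gcdS a00 prL UE).
have fibdvd s : exists U, fiber_poly (phi s) = U * map_poly phi L.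
  (* [F] is the fibre polynomial pulled back to [S]: a coefficient q(w) becomes q([sw]), since [sw]
     maps to w. *)
  pose F := map_poly (fun q => (map_poly kap q).[sw]) (phi s) - s%:P.
  have FE : map_poly phi F = fiber_poly (phi s).
    apply/polyP => i.
    have Fi : F`_i = (map_poly kap (phi s)`_i).[sw] - (if i == 0%N then s else 0).
      by rewrite coefB coefC coef_map_id0 // rmorph0 horner0.
    rewrite coef_map Fi coefB coef_map coefC [LHS](rmorphB phi); congr (_ - _); last first.
      by case: ifP => _ //; rewrite rmorph0.
    elim/poly_ind: ((phi s)`_i) => [|q c IH]; first by rewrite rmorph0 horner0 rmorph0.
    rewrite rmorphD rmorphM /= map_polyX map_polyC hornerD hornerMX hornerC.
    by rewrite rmorphD rmorphM /= IH swE phi_kap -polyCM -polyCD.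
  have [|U UE] := Ldvd F; first by rewrite /V /hor FE fiber_poly_root.
  by exists (map_poly phi U); rewrite -rmorphM -UE.
have [c [c0 cE]] : exists c, c != 0 /\ phi b' = c%:P%:P.
  (* At a zero of [phi b'] the relation [yE] makes [phi a'] vanish too, hence the image of [L] and
     every fibre polynomial, which [fiber_poly_nonvanishing] excludes. *)
  apply: nonvanishing_const => w0 y0; apply: contraT; rewrite negbK => /eqP zb.
  have za : evp w0 y0 (phi a') = 0 by rewrite -yE evpM zb mul0r.
  have evp_phiN t : evp w0 y0 (phi (- t)) = - evp w0 y0 (phi t).
    by rewrite (rmorphN phi) /evp /= /horner_eval !hornerN.
  have zfib s i : evp w0 y0 (fiber_poly (phi s))`_i = 0.
    have [U ->] := fibdvd s; rewrite -(coef_map (evp w0 y0)) rmorphM /=.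
    suff -> : map_poly (evp w0 y0) (map_poly phi L) = 0 by rewrite mulr0 coef0.
    apply/polyP => j; rewrite !coef_map coef0; case: j => [|[|j]].
    - by rewrite L0; apply: (etrans (evp_phiN a')); rewrite za oppr0.
    - by rewrite L1; apply: zb.
    - have -> : L`_j.+2 = 0 by apply: nth_default; apply: leq_trans sL _.
      apply: (etrans (congr1 (evp w0 y0) (rmorph0 phi))).
      by rewrite /evp /= /horner_eval !horner0.
  have [[i]|[i]] := fiber_poly_nonvanishing w0 y0; by rewrite zfib eqxx.
exists (kap c^-1 * a'); rewrite rmorphM -yE cE phi_kap mulrA -!rmorphM mulVf //.
by rewrite !rmorph1 mul1r.
Qed.

(** * Extending d/dT along a fraction y = e / c *)

Lemma lift_value_step (R : comNzRingType) (c z p q : R) n :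
  c ^+ n * p * (c * z) + c ^+ n.+1 * q = c ^+ n.+1 * (p * z + q).
Proof. by rewrite exprS; ring. Qed.

(** With z = e / c, the derivative of z is (e' - c' z) / c. The hypothesis is the product rule for
    c^n p, multiplied by c; the conclusion is the same rule for c^(n+1) (p z + q). *)
Lemma lift_step (R : comNzRingType) (c c' e' z p py pw q q' g : R) n :
  c * g = c ^+ n.+1 * pw + c ^+ n * (e' - c' * z) * py + n%:R * c ^+ n * c' * p ->
  c * (g * (c * z) + c ^+ n * p * e' + (c' * c ^+ n * n.+1%:R * q + c ^+ n.+1 * q')) =
  c ^+ n.+2 * (pw * z + q') + c ^+ n.+1 * (e' - c' * z) * (py * z + p)
    + n.+1%:R * c ^+ n.+1 * c' * (p * z + q).
Proof.
move=> e; transitivity (c * g * (c * z)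
    + c * (c ^+ n * p * e' + (c' * c ^+ n * n.+1%:R * q + c ^+ n.+1 * q'))); first by ring.
by rewrite e -natr1 !exprS; ring.
Qed.

(** Subtracting the derivative of c^n p with p held constant leaves the terms in [pw] and [py]. For
    n = 0 the exponent [n.-1] is harmless because of the factor [n%:R]. *)
Lemma kill_step (R : comNzRingType) (c c' e' z p py pw g : R) n :
  c * g = c ^+ n.+1 * pw + c ^+ n * (e' - c' * z) * py + n%:R * c ^+ n * c' * p ->
  c * (g - c' * c ^+ n.-1 * n%:R * p) = c ^+ n * (c * pw + (e' - c' * z) * py).
Proof. by move=> e; rewrite [LHS]mulrBr e; case: n {e} => [|n] /=; rewrite ?exprS; ring. Qed.

Lemma jac_step (R : comNzRingType) (c t pw py qw qy : R) :
  c * pw + t * py = 0 -> c * qw + t * qy = 0 -> c * (pw * qy - py * qw) = 0.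
Proof.
move=> e1 e2; transitivity ((c * pw + t * py) * qy - py * (c * qw + t * qy)); first by ring.
by rewrite e1 e2 mul0r mulr0 subrr.
Qed.

(* If y = b / c near the point, the derivation d/dT of A[T] at the point extends to D, where it
   kills P and Q but not w, against the Jacobian condition. *)
Lemma local_unramified w0 y0 :
  (exists C E, horw C * y = horw E /\ evp w0 y0 (horw C) != 0) ->
  exists G, horw G = 0 /\ evp w0 y0 (horw G^`()) != 0.
Proof.
move=> [C [E [yE cnz]]]; apply: contrapT => ram.
(* By contradiction: if all relations have derivative zero at the point, d/dT induces a derivation
   of B with values in K. *)
have {}ram G : horw G = 0 -> evp w0 y0 (horw G^`()) = 0.
  by move=> G0; apply/eqP; apply: contraT => nz; case: ram; exists G.
pose c := horw C; pose c' := horw C^`(); pose e' := horw E^`().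
(* A power of [c] brings any [p] into B, because [c * y] lies in B; the second equation is the
   product rule for c^n p with the denominator cleared. *)
have lift (p : D) : exists n G, horw G = c ^+ n * p /\
    c * horw G^`() = c ^+ n.+1 * dw p + c ^+ n * (e' - c' * y) * p^`() + n%:R * c ^+ n * c' * p.
  elim/poly_ind: p => [|p q [n [G [GE dGE]]]].
    exists 0%N, 0; rewrite deriv0 !hor0 deriv0 (raddf0 (@dw K)).
    by split; ring.
  have [Gq [GqE dGqE]] : exists Gq, horw Gq = q%:P /\ horw Gq^`() = q^`()%:P.
    elim/poly_ind: q => [|q a [Gq [IH1 IH2]]]; first by exists 0; rewrite !deriv0 !hor0.
    exists (Gq * 'X + (kap a)%:P); rewrite !derivD !derivM !derivX !derivC !horD !horM.
    rewrite hor1 hor0 !horC !horX IH1 IH2 phi_kap.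
    by rewrite !polyCD !polyCM polyC1 polyC0.
  have hE : horw (G * E + C ^+ n.+1 * Gq) = c ^+ n * p * (c * y) + c ^+ n.+1 * q%:P.
    by rewrite horD (horM _ G) (horM _ (C ^+ _)) horXn GE GqE -yE.
  have hE' : horw (G * E + C ^+ n.+1 * Gq)^`() =
      horw G^`() * (c * y) + c ^+ n * p * e' +
      (c' * c ^+ n * n.+1%:R * q%:P + c ^+ n.+1 * q^`()%:P).
    rewrite derivD (derivM G) (derivM (C ^+ _)) deriv_exp -mulr_natr horD.
    rewrite (horD _ (_ * E)) (horM _ _ E) (horM _ G) (horD _ (_ * Gq)) (horM _ _ Gq) (horM _ _ Gq^`()).
    by rewrite (horM _ _ n.+1%:R) (horM _ C^`()) hor_nat !horXn GE GqE dGqE -yE.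
  exists n.+1, (G * E + C ^+ n.+1 * Gq); rewrite hE hE'; split.
    exact: lift_value_step.
  have -> : dw (p * y + q%:P) = dw p * y + q^`()%:P by rewrite (raddfD (@dw K)) /= dwMX dwC.
  have -> : (p * y + q%:P)^`() = p^`() * y + p by rewrite derivD derivM derivX derivC mulr1 addr0.
  exact: lift_step.
pose t := e' - c' * y; pose ev := evp w0 y0.
(* [G] and C^n s both lift c^n [phi s], so by [ram] their derivatives agree at the point, where c^n
   can be cancelled. *)
have kill s : ev c * ev (dw (phi s)) + ev t * ev (phi s)^`() = 0.
  have [n [G [GE dGE]]] := lift (phi s).
  have /ram : horw (G - C ^+ n * s%:P) = 0 by rewrite horD horN horM horC horXn GE subrr.
  rewrite derivB derivM derivC mulr0 addr0 horD horN horM horC deriv_exp -mulr_natr horM.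
  rewrite horM hor_nat horXn -/c -/c' => ram0.
  have e0 : evp w0 y0 (c ^+ n * (c * dw (phi s) + t * (phi s)^`())) = 0.
    by rewrite -(kill_step dGE) evpM ram0 mulr0.
  move/eqP: e0; rewrite evpM mulf_eq0 => /orP [|/eqP <-]; last by rewrite evpD !evpM.
  by rewrite evpXn expf_eq0 (negPf cnz) andbF.
have : ev c * ev (dw P * Q^`() - P^`() * dw Q) = 0.
  by rewrite /ev evpB !evpM -/ev; apply: jac_step (kill sP) (kill sQ).
rewrite jacPQ /ev evpC => /eqP; rewrite mulf_eq0 (negPf jc0) orbF => e.
by rewrite e in cnz.
Qed.

End Core.

(** * Normal rings *)

Lemma tofrac_inj (R : idomainType) : injective (@FracField.tofrac R).
Proof. by move=> x y /eqP; rewrite tofrac_eq => /eqP. Qed.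

Definition subring_pred (R : pzRingType) (B : R -> Prop) :=
  [/\ B 1, forall a b, B a -> B b -> B (a - b) & forall a b, B a -> B b -> B (a * b)].

Section Subring.
Variables (R : pzRingType) (B : R -> Prop).
Hypothesis subB : subring_pred B.

Lemma subring1 : B 1. Proof. by case: subB. Qed.
Lemma subringB a b : B a -> B b -> B (a - b). Proof. by case: subB => _ h _; apply: h. Qed.
Lemma subringM a b : B a -> B b -> B (a * b). Proof. by case: subB => _ _; apply. Qed.
Lemma subring0 : B 0. Proof. by rewrite -(subrr 1); apply: subringB; apply: subring1. Qed.
Lemma subringN a : B a -> B (- a). Proof. by rewrite -sub0r; apply: subringB; apply: subring0. Qed.
Lemma subringD a b : B a -> B b -> B (a + b).
Proof. by move=> Ba Bb; rewrite -[b]opprK; apply/subringB/subringN. Qed.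
Lemma subringX a n : B a -> B (a ^+ n).
Proof. by move=> Ba; elim: n => [|n IH]; [apply: subring1 | rewrite exprS; apply: subringM]. Qed.
End Subring.

Section Localized.
Variables (R : idomainType) (B : R -> Prop) (K : fieldType) (e : {rmorphism R -> K}).
Hypothesis subB : subring_pred B.

(** Membership in the localization of [B] at the kernel of [e], stated without the fraction
    field. *)
Definition locally_in (r : R) := exists s, [/\ B s, e s != 0 & B (s * r)].

Lemma locally_in_incl r : B r -> locally_in r.
Proof. by move=> Br; exists 1; rewrite mul1r rmorph1 oner_eq0; split=> //; apply: subring1. Qed.

Lemma subring_locally_in : subring_pred locally_in.
Proof.
split; first by apply: locally_in_incl; apply: subring1.
- move=> a b [s [Bs s0 Bsa]] [t [Bt t0 Btb]]; exists (s * t).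
  split; [exact: subringM|by rewrite rmorphM mulf_neq0|].
  have -> : s * t * (a - b) = t * (s * a) - s * (t * b) by ring.
  by apply: (subringB subB); apply: subringM.
- move=> a b [s [Bs s0 Bsa]] [t [Bt t0 Btb]]; exists (s * t).
  split; [exact: subringM|by rewrite rmorphM mulf_neq0|].
  have -> : s * t * (a * b) = s * a * (t * b) by ring.
  exact: subringM.
Qed.

Lemma prime_ideal_kernel : prime_ideal B (fun b => B b /\ e b = 0).
Proof.
split.
- by move=> a [].
- split; first by split; [apply: subring0 | rewrite rmorph0].
  by move=> [_ /eqP]; rewrite rmorph1 oner_eq0.
- by move=> a b [Ba ea] [Bb eb]; split; [apply: subringD | rewrite rmorphD ea eb addr0].
- by move=> a b Ba [Bb eb]; split; [apply: subringM | rewrite rmorphM eb mulr0].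
- move=> a b Ba Bb [_ /eqP]; rewrite rmorphM mulf_eq0 => /orP [/eqP ea|/eqP eb]; by [left|right].
Qed.

Hypothesis normB : normal_ring B.

(** The fraction [m0 / m1] places [r] in the fraction field of [B]; normality is applied at the
    kernel of [e] and the result is pulled back along the injection into the fraction field. *)
Lemma normal_locally_integral (r m0 m1 : R) (g : {poly R}) :
  B m0 -> B m1 -> m1 != 0 -> m1 * r = m0 ->
  g \is monic -> (forall i, locally_in g`_i) -> root g r -> locally_in r.
Proof.
move=> Bm0 Bm1 m10 mr gm gB gr.
have loc_in s : locally_in s -> localization B (fun b => B b /\ e b = 0) (FracField.tofrac s).
  move=> [t [Bt t0 Bts]]; exists (t * s), t; split=> //; first by case=> _ /eqP; rewrite (negPf t0).
  have tF : FracField.tofrac t != 0 by rewrite tofrac_eq0; apply: contraNneq t0 => ->; rewrite rmorph0.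
  by rewrite tofracM mulrAC mulfV // mul1r.
have [||a [s [Ba Bs ns E]]] := normB prime_ideal_kernel (z := FracField.tofrac r).
- exists (FracField.tofrac m0), (FracField.tofrac m1); split; try exact/loc_in/locally_in_incl.
    by rewrite tofrac_eq0.
  by rewrite -mr tofracM mulrAC mulfV ?mul1r // tofrac_eq0.
- exists (map_poly (@FracField.tofrac R) g); split; first exact: monic_map.
    by move=> i; rewrite coef_map; apply: loc_in.
  exact: rmorph_root.
have es : e s != 0 by apply: contra_notN ns => /eqP.
have s0 : s != 0 by apply: contraNneq es => ->; rewrite rmorph0.
exists s; split=> //; suff -> : s * r = a by [].
apply: (@tofrac_inj R); rewrite tofracM E mulrC mulfVK // tofrac_eq0 //.
Qed.

(* If the leading coefficient c_n vanishes at the point, then c_n u is integral over the local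
   ring, hence in it, and c_n u^n may be absorbed in the next term without changing the
   reduction of the polynomial. *)
Lemma normal_local (u m0 m1 : R) : B m0 -> B m1 -> m1 != 0 -> m1 * u = m0 ->
  forall g : {poly R}, (forall i, locally_in g`_i) -> g.[u] = 0 -> (exists i, e g`_i != 0) ->
  locally_in u.
Proof.
move=> Bm0 Bm1 m10 mu g; have subL := subring_locally_in.
have [n] := ubnP (size g); elim: n g => // n IH g le gB gu [i0 gi0].
have g0 : g != 0 by apply: contraNneq gi0 => ->; rewrite coef0 rmorph0.
case sg: (size g) => [|[|k]].
- by move/eqP: sg; rewrite size_poly_eq0 (negPf g0).
- have gC : g = (g`_0)%:P by apply: size1_polyC; rewrite sg.
  by move: g0 gu; rewrite gC polyC_eq0 hornerC => /eqP.
set c := g`_k.+1.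
have c0 : c != 0 by move: g0; rewrite -lead_coef_eq0 /lead_coef sg.
have gE : \sum_(i < k.+2) g`_i * u ^+ i = 0 by move: gu; rewrite horner_coef sg.
have cu : locally_in (c * u).
  have [s [Bs s0 Bsc]] : locally_in c by apply: gB.
  have snz : s != 0 by apply: contraNneq s0 => ->; rewrite rmorph0.
  (* Multiplying g(u) = 0 by c^k turns it into the monic equation [h] for [c * u]. *)
  pose h1 := \poly_(i < k.+1) (g`_i * c ^+ (k - i)); pose h := 'X^(k.+1) + h1.
  have sh : (size h1 < size ('X^(k.+1) : {poly R}))%N.
    by rewrite size_polyXn ltnS size_poly.
  (* The factor [s] brings [c], which is only locally in [B], into [B]. *)
  apply: (@normal_locally_integral _ (s * c * m0) (s * m1) h).
  - exact: subringM.
  - exact: subringM.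
  - by rewrite mulf_neq0.
  - by rewrite -mu; ring.
  - by rewrite monicE lead_coefDl // lead_coefXn.
  - move=> i; rewrite coefD coefXn coef_poly; apply: (subringD subL).
      by case: (i == _); [apply: subring1 | apply: subring0].
    case: ifP => _; last exact: subring0.
    by apply: subringM => //; apply: subringX => //; apply: gB.
  - have hsum : \sum_(i < k.+1) g`_i * c ^+ (k - i) * (c * u) ^+ i = c ^+ k * \sum_(i < k.+1) g`_i * u ^+ i.
      rewrite mulr_sumr; apply: eq_bigr => i _; rewrite exprMn.
      have -> : c ^+ k = c ^+ (k - i) * c ^+ i by rewrite -exprD subnK // -ltnS.
      ring.
    rewrite /root hornerD hornerXn horner_poly hsum; apply/eqP.
    have -> : \sum_(i < k.+1) g`_i * u ^+ i = - (c * u ^+ k.+1).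
      by move: gE; rewrite big_ord_recr => /eqP; rewrite addr_eq0 => /eqP.
    by rewrite exprMn exprS; ring.
(* If [e c] is nonzero, [c] is invertible in the local ring and [c * u] already gives [u]. *)
have [ec|ec] := eqVneq (e c) 0; last first.
  have [s [Bs s0 Bsc]] : locally_in c by apply: gB.
  have [t [Bt t0 Btc]] := cu; exists (t * (s * c)); split; first exact: subringM.
    by rewrite !rmorphM !mulf_neq0.
  have -> : t * (s * c) * u = s * (t * (c * u)) by ring.
  exact: subringM.
pose g1 := \poly_(i < k.+1) (g`_i + (i == k)%:R * (c * u)).
apply: (IH g1).
- by apply: leq_ltn_trans (size_poly _ _) _; rewrite -sg.
- move=> i; rewrite coef_poly; case: ifP => _; last exact: subring0.
  apply: (subringD subL) => //; apply: (subringM subL) => //.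
  by case: (i == k); [apply: subring1 | apply: subring0].
- rewrite horner_poly big_ord_recr /= eqxx mul1r.
  under eq_bigr => i _ do rewrite (ltn_eqF (ltn_ord i)) mul0r addr0.
  by move: gE; rewrite 2!big_ord_recr /= -/c [u ^+ k.+1]exprS => E0; apply: etrans E0; ring.
- exists i0; rewrite coef_poly; have lt : (i0 < k.+2)%N.
    by rewrite ltnNge; apply: contraNN gi0 => le'; rewrite nth_default ?rmorph0 // sg.
  rewrite leq_eqVlt in lt; case/orP: lt => [/eqP [e0]|lt]; last first.
    by rewrite ltnS in lt; rewrite lt rmorphD !rmorphM ec mul0r mulr0 addr0.
  by move: gi0; rewrite e0 -/c ec eqxx.
Qed.
End Localized.

Lemma clear_denominator_step (F : fieldType) (s t x : F) (q : {poly F}) : s != 0 ->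
  s%:P * (t *: q) * 'X + t%:P * x%:P = (t * s) *: (q * 'X + (x / s)%:P).
Proof.
move=> s0; rewrite scalerDr -!mul_polyC -!polyCM; congr (_ + _%:P).
  by rewrite polyCM; ring.
by field.
Qed.

Lemma homogenize_step (F : fieldType) (a b t c d : F) n : b != 0 ->
  t * c * (a ^+ n * d) = d * b ^+ n * t * (c * (a / b) ^+ n).
Proof. by move=> b0; rewrite expr_div_n; field; rewrite expf_neq0. Qed.

(** Rational root argument: with z = a / b in lowest terms and the denominators of the monic
    equation of degree n cleared by some [t] outside [p], [b] divides a^n t, hence [t]; so [b] is
    outside [p]. *)
Lemma gcd_domain_normal (R : idomainType) (B : R -> Prop) :
  (forall r, B r) -> gcd_domain R -> normal_ring B.
Proof.
move=> Ball gcdR p [_ [p0 p1] pD pM pP] z [u [v [[a1 [s1 [_ _ ps1 uE]]] [a2 [s2 [_ _ ps2 vE]]] v0 zE]]].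
move=> [q [qm qD qz]].
have pnz s : ~ p s -> s != 0 by move=> ps; apply: contra_notN ps => /eqP ->.
have s10 := pnz _ ps1; have s20 := pnz _ ps2.
have a20 : a2 != 0 by apply: contraNneq v0 => a0; rewrite vE a0 tofrac0 mul0r.
have [g [a [b [aE bE b0 cop]]]] := reduced_fraction gcdR (a1 * s2) (mulf_neq0 s10 a20).
have g0 : g != 0.
  by apply: contraNneq (mulf_neq0 s10 a20) => g0; rewrite bE g0 mul0r.
have {}zE : z = FracField.tofrac a / FracField.tofrac b.
  have [t1 t2] : FracField.tofrac s1 != 0 /\ FracField.tofrac s2 != 0 by rewrite !tofrac_eq0.
  have [t3 t4] : FracField.tofrac a2 != 0 /\ FracField.tofrac b != 0 by rewrite !tofrac_eq0.
  have e : a1 * s2 * b = a * (s1 * a2) by rewrite aE bE; ring.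
  have := congr1 (@FracField.tofrac R) e; rewrite !tofracM => {}e.
  rewrite zE uE vE; apply/eqP; rewrite invf_div mulf_div eqr_div ?mulf_neq0 //; apply/eqP.
  by rewrite e.
have [t [pt [d dE]]] : exists t, ~ p t /\ exists d : {poly R},
    map_poly (@FracField.tofrac R) d = FracField.tofrac t *: q.
  elim/poly_ind: q qD {qm qz} => [|q c IH] qD.
    by exists 1; split=> //; exists 0; rewrite rmorph0 scaler0.
  have [i|t [pt [d dE]]] := IH; first by move: (qD i.+1); rewrite coefD coefMX coefC addr0.
  have [x [s [_ _ ps cE]]] := qD 0%N.
  rewrite coefD coefMX coefC add0r /= in cE.
  exists (t * s); split; first by case/pP => //.
  have sF : FracField.tofrac s != 0 by rewrite tofrac_eq0 pnz.
  exists (s%:P * d * 'X + (t * x)%:P).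
  rewrite rmorphD !rmorphM /= !map_polyC map_polyX dE /= cE.
  exact: clear_denominator_step.
case sq: (size q) => [|n]; first by move: (monic_neq0 qm); rewrite -size_poly_eq0 sq.
have dn : d`_n = t.
  apply: (@tofrac_inj R); rewrite -coef_map /= dE coefZ.
  by move: qm; rewrite monicE /lead_coef sq => /eqP ->; rewrite mulr1.
have sum0 : \sum_(i < n.+1) d`_i * (a ^+ i * b ^+ (n - i)) = 0.
  apply: (@tofrac_inj R); rewrite tofrac0 rmorph_sum /=.
  have bF : FracField.tofrac b != 0 by rewrite tofrac_eq0.
  transitivity (FracField.tofrac b ^+ n * FracField.tofrac t * q.[z]); last by rewrite (eqP qz) mulr0.
  rewrite horner_coef sq mulr_sumr; apply: eq_bigr => i _.
  have dEi : FracField.tofrac d`_i = FracField.tofrac t * q`_i by rewrite -coef_map dE coefZ.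
  have -> : FracField.tofrac b ^+ n = FracField.tofrac b ^+ (n - i) * FracField.tofrac b ^+ i.
    by rewrite -exprD subnK // -ltnS.
  by rewrite !tofracM !tofracXn dEi zE; apply: homogenize_step.
have bt : divides b (a ^+ n * t).
  move: sum0; rewrite big_ord_recr /= subnn expr0 mulr1 dn addrC mulrC => /eqP.
  rewrite addr_eq0 => /eqP ->; rewrite -sumrN.
  apply: (big_ind (divides b)); [exact: divides0 | exact: divides_addr |].
  move=> i _; rewrite -mulrN; apply: divides_mull; exists (- (a ^+ i * b ^+ (n - i).-1)).
  have -> : (n - i = (n - i).-1.+1)%N by rewrite prednK // subn_gt0.
  by rewrite exprS /=; ring.
have [r tE] := euclid_lemma gcdR (coprime_eltsX gcdR (n := n) cop) bt.
exists a, b; split=> //; move=> pb; apply: pt; rewrite tE; exact: pM.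
Qed.

(** * Tensor products, flatness and separability *)

Lemma fcoef_cat (T : eqType) (l l' : seq (int * T)) x :
  fcoef (l ++ l') x = fcoef l x + fcoef l' x.
Proof. exact: big_cat. Qed.

Lemma fcoef_cons (T : eqType) (k : int) (t : T) l x :
  fcoef ((k, t) :: l) x = (if t == x then k else 0) + fcoef l x.
Proof. by rewrite /fcoef big_cons /=; case: ifP => _ //; rewrite add0r. Qed.

Lemma fcoef_nil (T : eqType) (x : T) : fcoef [::] x = 0.
Proof. exact: big_nil. Qed.

Section Formal.
Variables (T : eqType) (V : zmodType) (F : T -> V).

(** The homomorphism from the free abelian group on [T] that extends [F]. *)
Definition fsum (l : seq (int * T)) : V := \sum_(t <- l) F t.2 *~ t.1.

Lemma fsum_cat l l' : fsum (l ++ l') = fsum l + fsum l'.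
Proof. exact: big_cat. Qed.

Lemma fsum_fcoef (l : seq (int * T)) (s : seq T) : uniq s ->
  {subset [seq t.2 | t <- l] <= s} -> fsum l = \sum_(x <- s) F x *~ fcoef l x.
Proof.
move=> us; elim: l => [|[k t] l IH] sub.
  by rewrite /fsum big_nil big1_seq // => x _; rewrite fcoef_nil mulr0z.
rewrite /fsum big_cons -/(fsum l) IH; last by move=> x xl; apply: sub; rewrite inE xl orbT.
under [RHS]eq_bigr => x _ do rewrite fcoef_cons mulrzDr.
rewrite big_split /=; congr (_ + _).
have ts : t \in s by apply: sub; rewrite inE eqxx.
rewrite (bigD1_seq t) //= eqxx big1 ?addr0 // => x /negPf.
by rewrite eq_sym => ->; rewrite mulr0z.
Qed.

Lemma eq_fsum (l l' : seq (int * T)) : (forall x, fcoef l x = fcoef l' x) -> fsum l = fsum l'.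
Proof.
move=> e; pose s := undup [seq t.2 | t <- l ++ l'].
rewrite (@fsum_fcoef l s) ?(@fsum_fcoef l' s) ?undup_uniq //.
- by apply: eq_bigr => x _; rewrite e.
- by move=> x xl; rewrite mem_undup map_cat mem_cat xl orbT.
- by move=> x xl; rewrite mem_undup map_cat mem_cat xl.
Qed.
End Formal.

Section Tensor.
Variables (R : comNzRingType) (S : R -> Prop) (M N : zmodType).
Variables (actM : R -> M -> M) (actN : R -> N -> N).

(** A balanced biadditive map kills each defining relation, hence factors through the tensor
    product. *)
Lemma tensor_zero_balanced (V : zmodType) (b : M -> N -> V) (l : seq (M * N)) :
  (forall m m' n, b (m + m') n = b m n + b m' n) ->
  (forall m n n', b m (n + n') = b m n + b m n') ->
  (forall a m n, S a -> b (actM a m) n = b m (actN a n)) ->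
  tensor_zero S actM actN l -> \sum_(p <- l) b p.1 p.2 = 0.
Proof.
move=> bDl bDr bS [rs [ok e]]; have := @eq_fsum _ _ (fun p => b p.1 p.2) _ _ e.
have -> : fsum (fun p => b p.1 p.2) [seq (1, p) | p <- l] = \sum_(p <- l) b p.1 p.2.
  by rewrite /fsum big_map; apply: eq_bigr => p _; rewrite mulr1z.
move=> ->; elim: rs ok {e} => [|[k g] rs IH] ok; first by rewrite /fsum big_nil.
rewrite /= fsum_cat IH; last by move=> kg h; apply: ok; right.
rewrite addr0 /fsum big_map /=.
have := ok (k, g) (or_introl erefl); case: g {ok} => [m m' n|m n n'|a m n] /= Sa.
- by rewrite !big_cons big_nil /= bDl !mulr1 !mulrN1 mulrzDl !mulrNz addr0 -opprD subrr.
- by rewrite !big_cons big_nil /= bDr !mulr1 !mulrN1 mulrzDl !mulrNz addr0 -opprD subrr.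
- by rewrite !big_cons big_nil /= bS // !mulr1 !mulrN1 !mulrNz addr0 subrr.
Qed.

(** [tensor_zero] with integer coefficients: negative terms let relations be added and cancelled in
    an induction. *)
Definition formal_zero (l : seq (int * (M * N))) := exists rs : seq (int * tgen R M N),
  (forall kg, In_seq kg rs -> tgen_ok S kg.2) /\
  forall x, fcoef l x = fcoef (flatten [seq [seq (kg.1 * t.1, t.2) | t <- tgen_exp actM actN kg.2]
                                       | kg <- rs]) x.

Lemma formal_zero_eq l l' : (forall x, fcoef l x = fcoef l' x) -> formal_zero l -> formal_zero l'.
Proof. by move=> e [rs [ok h]]; exists rs; split=> // x; rewrite -e. Qed.

Lemma formal_zero_cat l l' : formal_zero l -> formal_zero l' -> formal_zero (l ++ l').
Proof.
move=> [rs [ok e]] [rs' [ok' e']]; exists (rs ++ rs'); split.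
  move=> kg; elim: rs ok {e} => [|g rs IH] ok /=; first exact: ok'.
  by move=> [<-|h]; [apply: ok; left | apply: IH h => kg' h'; apply: ok; right].
by move=> x; rewrite map_cat flatten_cat !fcoef_cat e e'.
Qed.

Lemma formal_zero_gen k g : tgen_ok S g ->
  formal_zero [seq (k * t.1, t.2) | t <- tgen_exp actM actN g].
Proof. by move=> ok; exists [:: (k, g)]; split=> [kg [<-|[]] | x] //=; rewrite cats0. Qed.
End Tensor.

Section Flat.
Variable R : idomainType.
Variables (B : R -> Prop) (K : fieldType) (e : {rmorphism R -> K}).
Hypothesis subB : subring_pred B.
Variables (a b z : R).
Hypotheses (Ba : B a) (Bb : B b) (b0 : b != 0) (bz : b * z = a).

Definition pair_ideal : {pred R} := fun x => `[< exists c d, [/\ B c, B d & x = c * a + d * b] >].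

Fact pair_ideal_zmod : zmod_closed pair_ideal.
Proof.
split; first by apply/asboolP; exists 0, 0; split; [exact: subring0|exact: subring0|ring].
move=> x y /asboolP [c [d [Bc Bd ->]]] /asboolP [c' [d' [Bc' Bd' ->]]]; apply/asboolP.
by exists (c - c'), (d - d'); split; [exact: subringB|exact: subringB|ring].
Qed.
HB.instance Definition _ := GRing.isZmodClosed.Build R pair_ideal pair_ideal_zmod.

(** The ideal becomes a type because [flat_over] quantifies over types with a group structure. *)
Record pair_ideal_type := PairIdeal { pi_val : R; pi_valP : pi_val \in pair_ideal }.
HB.instance Definition _ := [isSub for pi_val].
HB.instance Definition _ := [Choice of pair_ideal_type by <:].
HB.instance Definition _ := [SubChoice_isSubZmodule of pair_ideal_type by <:].

(** For [r] outside [B] the product may leave the ideal and [insubd] returns the default [m];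
    [smodule] only tests [r] in [B]. *)
Definition pi_act (r : R) (m : pair_ideal_type) : pair_ideal_type := insubd m (r * val m).

Lemma pi_actE r m : B r -> val (pi_act r m) = r * val m.
Proof.
move=> Br; rewrite val_insubd ifT //; case: m => m /= /asboolP [c [d [Bc Bd ->]]].
by apply/asboolP; exists (r * c), (r * d); split; [exact: subringM|exact: subringM|ring].
Qed.

Lemma pi_smodule : smodule B pi_act.
Proof.
split.
- by move=> r m m' Br; apply: val_inj; rewrite raddfD /= !pi_actE // raddfD mulrDr.
- by move=> r s m Br Bs; apply: val_inj; rewrite raddfD /= !pi_actE //; [rewrite mulrDl|exact: subringD].
- by move=> r s m Br Bs; apply: val_inj; rewrite !pi_actE //; [rewrite mulrA|exact: subringM].
- by move=> m; apply: val_inj; rewrite pi_actE ?mul1r //; apply: subring1.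
Qed.

(* If no denominator of z is nonzero at e, then (c a + d b, r) |-> e (c r) is a well defined
   balanced map on J x R, J = aB + bB, which does not kill the element a (x) 1 - b (x) z;
   but that element vanishes in B (x) R. *)
Lemma flat_local : flat_over B (fun r s : R => r * s) -> exists s, [/\ B s, e s != 0 & B (s * z)].
Proof.
move=> flat; apply: contrapT => no.
have van s : B s -> B (s * z) -> e s = 0.
  by move=> Bs Bsz; apply/eqP; apply: contraT => s0; case: no; exists s.
have dec (m : pair_ideal_type) : exists cd, [/\ B cd.1, B cd.2 & val m = cd.1 * a + cd.2 * b].
  by case: m => m /= /asboolP [c [d ?]]; exists (c, d).
have [cd cdP] := choice dec.
(* Two expressions c a + d b of the same element differ in [c] by some s with s z in [B], and [e]
   kills such s. *)
have cE m c d : B c -> B d -> val m = c * a + d * b -> e (cd m).1 = e c.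
  move=> Bc Bd mE; have [Bc' Bd' mE'] := cdP m; apply/eqP; rewrite -subr_eq0 -rmorphB; apply/eqP.
  apply: van; first exact: subringB.
  suff -> : ((cd m).1 - c) * z = d - (cd m).2 by apply: subringB.
  apply: (mulIf b0); move: mE; rewrite mE' -bz => mE.
  apply/eqP; rewrite -subr_eq0; apply/eqP.
  have -> : ((cd m).1 - c) * z * b - (d - (cd m).2) * b
     = ((cd m).1 * (b * z) + (cd m).2 * b) - (c * (b * z) + d * b) by ring.
  by rewrite mE subrr.
have aJ : a \in pair_ideal.
  by apply/asboolP; exists 1, 0; split; [exact: subring1|exact: subring0|ring].
have bJ : b \in pair_ideal.
  by apply/asboolP; exists 0, 1; split; [exact: subring0|exact: subring1|ring].
pose l := [:: (PairIdeal aJ, 1); (PairIdeal bJ, - z)].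
have smR : smodule B (fun r s : R => r * s).
  by split=> *; rewrite ?mulrDr ?mulrDl ?mulrA ?mul1r.
have tz : tensor_zero B pi_act (fun r s : R => r * s) l.
  apply: (flat _ _ pi_act (fun r s : R => r * s) val pi_smodule smR).
  - by move=> x y; rewrite raddfD.
  - by move=> r m Br; rewrite pi_actE.
  - exact: val_inj.
  (* The first two relations turn a (x) 1 into 1 (x) a and b (x) (-z) into 1 (x) (-a); the last two
     add these up to 1 (x) 0 and remove it. *)
  exists [:: (1, TgB a 1 1); (1, TgB b 1 (- z)); (-1, TgR R 1 a (- a)); (-1, TgR R 1 0 0)].
  split; first by move=> kg /= [<-|[<-|[<-|[<-|[]]]]].
  move=> x; rewrite /= !fcoef_cons !fcoef_nil !mulr1 (mulrN b z) bz subrr addr0 (addr0 (0 : R)).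
  by do ![case: ifP => _].
(* On [l] the balanced map takes the value e(1) e(1) + e(0) e(-z) = 1. *)
have := @tensor_zero_balanced _ _ _ _ _ _ _ (fun m r => e (cd m).1 * e r) l _ _ _ tz.
rewrite /l !big_cons big_nil /= => /(_ _ _ _) h.
suff : (1 : K) = 0 by move/eqP; rewrite oner_eq0.
rewrite -[RHS]h.
- rewrite (@cE _ 1 0) ?(@cE _ 0 1) /=; first by rewrite rmorph0 mul0r !addr0 !rmorph1 mulr1.
  + exact: subring0. + exact: subring1. + by ring.
  + exact: subring1. + exact: subring0. + by ring.
- move=> m m' n; have [Bc Bd mE] := cdP m; have [Bc' Bd' mE'] := cdP m'.
  rewrite (@cE (m + m') ((cd m).1 + (cd m').1) ((cd m).2 + (cd m').2)).
  + by rewrite rmorphD mulrDl. + exact: subringD. + exact: subringD.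
  + by transitivity (val m + val m'); [exact: raddfD | rewrite mE mE'; ring].
- by move=> m n n'; rewrite rmorphD mulrDr.
- move=> r m n Br; have [Bc Bd mE] := cdP m.
  rewrite (@cE (pi_act r m) (r * (cd m).1) (r * (cd m).2)).
  + by rewrite !rmorphM; ring. + exact: subringM. + exact: subringM.
  + by rewrite pi_actE // mE; ring.
Qed.
End Flat.

(** Over the full ring m (x) r = r m (x) 1, so a tensor vanishes as soon as the sum of the r m does;
    injectivity of [f] carries this back from [M2] to [M1]. *)
Lemma flat_self (R : comNzRingType) (B : R -> Prop) : (forall r, B r) ->
  flat_over B (fun r s : R => r * s).
Proof.
move=> Ball M1 M2 act1 act2 f [D1 A1 C1 U1] [D2 A2 C2 U2] fD fact finj l tz.
have f0 : f 0 = 0 by apply: (addIr (f 0)); rewrite -fD !add0r.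
have sum2 : \sum_(p <- l) act2 p.2 (f p.1) = 0.
  have := @tensor_zero_balanced _ _ _ _ _ _ _ (fun m r => act2 r m) _ _ _ _ tz.
  rewrite big_map; apply=> /=.
  - by move=> m m' r; apply: D2.
  - by move=> m r r'; apply: A2.
  - by move=> r m s _; rewrite mulrC; symmetry; apply: C2.
have sum1 : \sum_(p <- l) act1 p.2 p.1 = 0.
  apply: finj; rewrite f0 -sum2; elim: (l) => [|p l' IH]; first by rewrite !big_nil.
  by rewrite !big_cons fD IH fact.
have key (l' : seq (M1 * R)) : formal_zero B act1 (fun r s : R => r * s)
    ([seq (1, p) | p <- l'] ++ [:: (-1, (\sum_(p <- l') act1 p.2 p.1, 1))]).
  elim: l' => [|[m r] l' IH].
    rewrite big_nil; apply: formal_zero_eq (formal_zero_gen _ _ 1 (g := TgL R 0 0 1) I) => x.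
    by rewrite /= !fcoef_cons !fcoef_nil !addr0; case: ifP => _; ring.
  rewrite big_cons; set s := \sum_(p <- l') _ in IH *.
  have h1 := @formal_zero_gen _ B _ _ act1 (fun r s : R => r * s) (-1) (TgL R (act1 r m) s 1) I.
  have h2 := @formal_zero_gen _ B _ _ act1 (fun r s : R => r * s) (-1) (TgB r m 1) (Ball r).
  apply: formal_zero_eq (formal_zero_cat IH (formal_zero_cat h1 h2)) => x.
  rewrite !fcoef_cat /= !fcoef_cons !fcoef_nil !addr0 (mulr1 r).
  do ![case: ifP => _]; ring.
(* The relation 0 + 0 = 0 in the first factor cancels the remaining term 0 (x) 1. *)
have h1 := @formal_zero_gen _ B _ _ act1 (fun r s : R => r * s) (-1) (TgL R 0 0 1) I.
have [rs [ok h]] : formal_zero B act1 (fun r s : R => r * s) [seq (1, p) | p <- l].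
  have := key l; rewrite sum1 => k; apply: formal_zero_eq (formal_zero_cat k h1) => x.
  rewrite !fcoef_cat /= !fcoef_cons !fcoef_nil !addr0.
  by case: ifP => _; ring.
by exists rs.
Qed.

Section Separable.
Variables (R : comNzRingType) (A B : R -> Prop).

(* The derivation twists the second action on R x K; a splitting of the projection to R
   forces it to vanish. *)
Lemma separable_derivation (K : fieldType) (e : {rmorphism R -> K}) (del : R -> K) :
  subring_pred B -> (forall r, A r -> B r) -> separable_over A B ->
  (forall r s, B r -> B s -> del (r + s) = del r + del s) ->
  (forall r s, B r -> B s -> del (r * s) = e r * del s + del r * e s) ->
  (forall r, A r -> del r = 0) ->
  forall r, B r -> del r = 0.
Proof.
move=> subB AB sep delD delM delA.
have del1 : del 1 = 0.
  have := delM 1 1 (subring1 subB) (subring1 subB); rewrite mulr1 rmorph1 mul1r mulr1 => /eqP.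
  by rewrite -subr_eq0 opprD addrA subrr sub0r oppr_eq0 => /eqP.
pose lM (r : R) (m : R * K) : R * K := (r * m.1, e r * m.2).
pose rM (r : R) (m : R * K) : R * K := (r * m.1, e r * m.2 + del r * e m.1).
pose lN (r s : R) := r * s.
have smN : smodule B lN by split=> *; rewrite /lN ?mulrDr ?mulrDl ?mulrA ?mul1r.
have envN : env_module A B lN lN.
  by split=> // *; rewrite /lN mulrCA.
have envM : env_module A B lM rM.
  split.
  - split=> [r [x k] [x' k'] _|r s [x k] _ _|r s [x k] _ _|[x k]]; rewrite /lM /=.
    + by rewrite !mulrDr.
    + by rewrite rmorphD !mulrDl.
    + by rewrite rmorphM !mulrA.
    + by rewrite rmorph1 !mul1r.
  - split=> [r [x k] [x' k'] _|r s [x k] Br Bs|r s [x k] Br Bs|[x k]]; rewrite /rM /=.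
    + by congr pair; rewrite ?mulrDr // rmorphD /=; ring.
    + by congr pair; rewrite ?mulrDl // rmorphD delD //=; ring.
    + by congr pair; rewrite ?mulrA // !rmorphM delM //=; ring.
    + by rewrite rmorph1 del1 !mul1r mul0r addr0.
  - by move=> r s [x k] Br Bs; rewrite /lM /rM /=; congr pair; rewrite ?rmorphM; ring.
  - by move=> r [x k] Ar; rewrite /lM /rM /= delA // mul0r addr0.
have [|x||k [[kD kl kr] kh] r Br] := sep _ _ lM rM lN lN (@fst R K) id envM envN.
- by split=> [[x k] [x' k']|r [x k]|r [x k]].
- by exists (x, 0).
- by split.
have k1 : (k 1).1 = 1 by apply: kh; apply: subring1.
(* Both actions of [r] on [k 1] give [k (r * 1)]; as [k 1] has first component 1, their second
   components differ by [del r]. *)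
have := kl r 1 Br (subring1 subB); rewrite (kr r 1 Br (subring1 subB)) /lM /rM => -[].
by rewrite k1 rmorph1 mulr1 => /eqP; rewrite -subr_eq0 addrC addKr => /eqP.
Qed.

(** Any lift [m] of [h 1] gives a lift of [h]; the two actions agree because [A] is everything. *)
Lemma separable_self : (forall r, A r) -> (forall r, B r) -> separable_over A B.
Proof.
move=> Aall Ball M N lM rM lN rN g h [smM _ _ lrM] [smN _ _ lrN] [gD gl gr] gsur [hD hl hr].
have [m gm] := gsur (h 1); case: smM => D1 A1 C1 U1.
exists (fun r => lM r m); split; first split.
- by move=> r s _ _; apply: A1.
- by move=> r s _ _; apply: C1.
- by move=> r s _ _; rewrite C1 // lrM.
- by move=> r _; rewrite gl // gm -hl // mulr1.
Qed.
End Separable.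

(** * Bivariate polynomials *)

Lemma mpoly_alg_ind (R : comNzRingType) n (Pr : {mpoly R[n]} -> Prop) :
  (forall c, Pr c%:MP) -> (forall i, Pr 'X_i) ->
  (forall p q, Pr p -> Pr q -> Pr (p + q)) -> (forall p q, Pr p -> Pr q -> Pr (p * q)) ->
  forall p, Pr p.
Proof.
move=> PC PX PD PM; elim/mpolyind => [|c m p _ _ IH]; first by rewrite -mpolyC0.
apply: PD => //; rewrite -mul_mpolyC; apply: (PM) => //.
rewrite mpolyXE_id; apply: (big_ind Pr); [by rewrite -mpolyC1 | exact: PM |].
move=> i _; elim: (m i) => [|k IHk]; first by rewrite expr0 -mpolyC1.
by rewrite exprS; apply: PM.
Qed.

Lemma ord2P (i : 'I_2) : i = 0 \/ i = 1.
Proof. by case: i => [[|[|//]] lt]; [left|right]; apply: val_inj. Qed.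

Section Coordinates.
Variable K : closedFieldType.
Local Notation R := {mpoly K[2]}.
Local Notation D := {poly {poly K}}.
Local Notation x := ('X_(0 : 'I_2) : R).
Local Notation y := ('X_(1 : 'I_2) : R).

(* The coordinates w = x + y (inner variable) and y (outer variable). *)
Definition iota : R -> D :=
  mmap (@polyC {poly K} \o @polyC K) (fun i : 'I_2 => if i == 0 then 'X%:P - 'X else 'X).
HB.instance Definition _ := GRing.RMorphism.on iota.

Definition jota_w : {poly K} -> R :=
  horner_morph (f := @mpolyC 2 K) (u := x + y) (fun a => mulrC _ _).
HB.instance Definition _ := GRing.RMorphism.on jota_w.

Definition jota : D -> R := horner_morph (f := jota_w) (u := y) (fun a => mulrC _ _).
HB.instance Definition _ := GRing.RMorphism.on jota.

Lemma iotaD p q : iota (p + q) = iota p + iota q. Proof. exact: (rmorphD iota). Qed.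
Lemma iotaM p q : iota (p * q) = iota p * iota q. Proof. exact: (rmorphM iota). Qed.

Lemma jotaM p q : jota (p * q) = jota p * jota q. Proof. exact: (rmorphM jota). Qed.

Lemma iotaC c : iota c%:MP = c%:P%:P.
Proof. by rewrite /iota mmapC. Qed.

Lemma iotaX i : iota 'X_i = if i == 0 then 'X%:P - 'X else 'X.
Proof. by rewrite /iota mmapX mmap1U. Qed.

Lemma iota_w : iota (x + y) = 'X%:P.
Proof. by rewrite rmorphD /= !iotaX eqxx subrK. Qed.

Lemma jotaC c : jota c%:P%:P = c%:MP.
Proof. by transitivity (jota_w c%:P); apply: horner_morphC. Qed.

Lemma jota_wE : jota 'X%:P = x + y.
Proof. by transitivity (jota_w 'X); [apply: horner_morphC | apply: horner_morphX]. Qed.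

Lemma jota_y : jota 'X = y.
Proof. exact: horner_morphX. Qed.

Lemma iotaK : cancel iota jota.
Proof.
elim/mpoly_alg_ind => [c|i|p q Hp Hq|p q Hp Hq].
- by rewrite iotaC jotaC.
- rewrite iotaX; have [->|->] := ord2P i; last by rewrite /= jota_y.
  by rewrite eqxx rmorphB /= jota_wE jota_y addrK.
- by rewrite !rmorphD /= Hp Hq.
- by rewrite !rmorphM /= Hp Hq.
Qed.

Lemma jotaK : cancel jota iota.
Proof.
elim/poly_ind => [|p q IH]; first by rewrite !rmorph0.
rewrite !rmorphD !rmorphM /= IH jota_y iotaX /=; congr (_ + _).
elim/poly_ind: q {p IH} => [|q c IH]; first by rewrite !rmorph0.
by rewrite !polyCD !polyCM !rmorphD !rmorphM /= IH jota_wE iota_w jotaC iotaC.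
Qed.

Lemma iota_inj : injective iota. Proof. exact: can_inj iotaK. Qed.

Lemma iota_deriv0 p : iota (mderiv 0 p) = dw (iota p).
Proof.
elim/mpoly_alg_ind: p => [c|i|p q Hp Hq|p q Hp Hq].
- by rewrite mderivC rmorph0 iotaC dwC derivC polyC0.
- rewrite mderivX mnmE iotaX; have [->|->] := ord2P i.
  + rewrite eqxx scale1r (_ : (_ - _)%MM = 0%MM) ?mpolyX0 ?rmorph1.
      by rewrite (raddfB (@dw K)) /= dwC dwX derivX subr0.
    by apply/mnmP => j; rewrite !mnmE subnn.
  + by rewrite scale0r rmorph0 dwX.
- by rewrite mderivD !rmorphD /= (raddfD (@dw K)) /= Hp Hq.
- by rewrite mderivM rmorphD !rmorphM /= dwM Hp Hq.
Qed.

(** Moving y with x fixed moves w = x + y as well, whence the extra term; it cancels in the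
    Jacobian. *)
Lemma iota_deriv1 p : iota (mderiv 1 p) = (iota p)^`() + dw (iota p).
Proof.
elim/mpoly_alg_ind: p => [c|i|p q Hp Hq|p q Hp Hq].
- by rewrite mderivC rmorph0 iotaC dwC !derivC polyC0 addr0.
- rewrite mderivX mnmE iotaX; have [->|->] := ord2P i.
  + rewrite eqxx scale0r rmorph0 (raddfB (@dw K)) /= dwC dwX derivX derivB derivX derivC.
    by rewrite polyC1; ring.
  + rewrite scale1r (_ : (_ - _)%MM = 0%MM) ?mpolyX0 ?rmorph1.
      by rewrite /= dwX derivX addr0.
    by apply/mnmP => j; rewrite !mnmE subnn.
- by rewrite mderivD !rmorphD /= (raddfD (@dw K)) derivD /= Hp Hq; ring.
- by rewrite mderivM rmorphD !rmorphM /= dwM derivM Hp Hq; ring.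
Qed.

Lemma iota_jac p q :
  iota (jac2 p q) = dw (iota p) * (iota q)^`() - (iota p)^`() * dw (iota q).
Proof. by rewrite /jac2 rmorphB !rmorphM /= !iota_deriv0 !iota_deriv1; ring. Qed.

End Coordinates.

Lemma gcd_domain_retract (R S : idomainType) (i : {rmorphism R -> S}) (j : {rmorphism S -> R}) :
  cancel i j -> gcd_domain S -> gcd_domain R.
Proof.
move=> ij gcdS a b; have [g [[u gu] [v gv] gmax]] := gcdS (i a) (i b); exists (j g); split.
- by exists (j u); rewrite -rmorphM -gu ij.
- by exists (j v); rewrite -rmorphM -gv ij.
- move=> d [r rE] [s sE]; have [||t tE] := gmax (i d).
  + by exists (i r); rewrite -rmorphM -rE.
  + by exists (i s); rewrite -rmorphM -sE.
  + by exists (j t); rewrite tE rmorphM ij.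
Qed.

Lemma gcd_domain_mpoly2 (K : closedFieldType) : gcd_domain {mpoly K[2]}.
Proof.
apply: (gcd_domain_retract (@iotaK K)).
exact: gcd_domain_poly (gcd_domain_poly (@gcd_domain_field K)).
Qed.

Section GenSubalg.
Variables (K : fieldType) (n k : nat) (t : n.-tuple {mpoly K[k]}).

Lemma gen_subalgC c : gen_subalg t c%:MP.
Proof. by exists c%:MP; rewrite comp_mpolyC. Qed.
Lemma gen_subalgX i : gen_subalg t t`_i.
Proof.
have [lt|le] := ltnP i n; first by exists 'X_(Ordinal lt); rewrite comp_mpolyXU.
by rewrite nth_default ?size_tuple // -mpolyC0; apply: gen_subalgC.
Qed.
Lemma gen_subalgD p q : gen_subalg t p -> gen_subalg t q -> gen_subalg t (p + q).
Proof. by move=> [g ->] [h ->]; exists (g + h); rewrite comp_mpolyD. Qed.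
Lemma gen_subalgM p q : gen_subalg t p -> gen_subalg t q -> gen_subalg t (p * q).
Proof. by move=> [g ->] [h ->]; exists (g * h); rewrite rmorphM. Qed.
Lemma gen_subalgB p q : gen_subalg t p -> gen_subalg t q -> gen_subalg t (p - q).
Proof. by move=> [g ->] [h ->]; exists (g - h); rewrite comp_mpolyB. Qed.

Lemma subring_gen_subalg : subring_pred (gen_subalg t).
Proof.
split; [by rewrite -mpolyC1; apply: gen_subalgC | exact: gen_subalgB | exact: gen_subalgM].
Qed.
End GenSubalg.

(** * The theorem *)

Section KellerMap.
Variables (K : closedFieldType) (hK : [pchar K] =i pred0).
Local Notation R := {mpoly K[2]}.
Local Notation D := {poly {poly K}}.
Local Notation x := ('X_(0 : 'I_2) : R).
Local Notation y := ('X_(1 : 'I_2) : R).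
Variables (f : {lrmorphism R -> R}) (jc : K).
Hypotheses (jc0 : jc != 0) (jacf : jac2 (f x) (f y) = jc%:MP).

Lemma f_const c : f c%:MP = c%:MP.
Proof. by rewrite -!alg_mpolyC linearZ rmorph1. Qed.

Lemma f_comp h : comp_mpoly [tuple f x; f y] h = f h.
Proof.
elim/mpoly_alg_ind: h => [c|i|p q Hp Hq|p q Hp Hq].
- by rewrite comp_mpolyC f_const.
- by rewrite comp_mpolyXU; have [->|->] := ord2P i.
- by rewrite comp_mpolyD rmorphD Hp Hq.
- by rewrite !rmorphM /= Hp Hq.
Qed.

Lemma mderiv_var (i j : 'I_2) : mderiv i ('X_j : R) = (i == j)%:R.
Proof.
rewrite mderivX mnmE eq_sym; have [->|_] := eqVneq i j; last by rewrite scale0r.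
rewrite scale1r (_ : (_ - _)%MM = 0%MM) ?mpolyX0 //.
by apply/mnmP => k; rewrite !mnmE subnn.
Qed.

Lemma chain_rule i h :
  mderiv i (f h) = f (mderiv 0 h) * mderiv i (f x) + f (mderiv 1 h) * mderiv i (f y).
Proof.
elim/mpoly_alg_ind: h => [c|j|p q Hp Hq|p q Hp Hq].
- by rewrite f_const !mderivC rmorph0; ring.
- by rewrite !mderiv_var !rmorph_nat; have [->|->] := ord2P j; rewrite /= ?eqxx; ring.
- by rewrite rmorphD !mderivD Hp Hq !rmorphD; ring.
- by rewrite rmorphM !mderivM Hp Hq !rmorphD !rmorphM /=; ring.
Qed.

Lemma msize_mderiv_le i (h : R) n : (msize h <= n.+1)%N -> (msize (mderiv i h) <= n)%N.
Proof.
move=> le; rewrite msizeE; apply/bigmax_leqP_seq => m; rewrite mcoeff_msupp => nz _.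
have : (m + U_(i))%MM \in msupp h.
  by rewrite mcoeff_msupp; apply: contraNneq nz => z; rewrite mcoeff_mderiv z mul0rn.
move/msize_mdeg_lt; rewrite mdegD mdeg1 addn1 => lt.
by rewrite -ltnS; apply: leq_trans lt le.
Qed.

Lemma mderiv_eq0_const (h : R) : mderiv 0 h = 0 -> mderiv 1 h = 0 -> h = (h@_0%MM)%:MP.
Proof.
move=> h0 h1; apply/mpolyP => m; rewrite mcoeffC.
have [->|m0] := eqVneq m 0%MM; first by rewrite mulr1.
rewrite mulr0.
have [i [mi hi]] : exists i, (0 < m i)%N /\ mderiv i h = 0.
  have [e0|p0] := posnP (m 0); last by exists 0.
  have [e1|p1] := posnP (m 1); last by exists 1.
  case/eqP: m0; apply/mnmP => i; rewrite mnmE; by have [->|->] := ord2P i.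
have := congr1 (mcoeff (m - U_(i))%MM) hi.
rewrite mcoeff_mderiv mcoeff0 submK; last first.
  by apply/mnm_lepP => j; rewrite mnmE; have [<-|_] := eqVneq i j.
move/eqP; rewrite -mulr_natr mulf_eq0 => /orP [/eqP //|].
by move/pcharf0P: hK => ->.
Qed.

(** If f h = 0, the chain rule and Cramer's rule put both partial derivatives of h in the kernel.
    They have smaller degree, so by induction they vanish; in characteristic zero h is then a
    constant, which f fixes. *)
Lemma f_inj : injective f.
Proof.
apply: raddf_inj => h.
have [n] := ubnP (msize h); elim: n h => // n IH h le fh.
have d0 : f (mderiv 0 h) * jc%:MP = 0.
  transitivity (mderiv 0 (f h) * mderiv 1 (f y) - mderiv 1 (f h) * mderiv 0 (f y)).
    by rewrite (chain_rule 0 h) (chain_rule 1 h) -jacf /jac2; ring.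
  by rewrite fh !mderiv0 !mul0r subrr.
have d1 : f (mderiv 1 h) * jc%:MP = 0.
  transitivity (mderiv 1 (f h) * mderiv 0 (f x) - mderiv 0 (f h) * mderiv 1 (f x)).
    by rewrite (chain_rule 0 h) (chain_rule 1 h) -jacf /jac2; ring.
  by rewrite fh !mderiv0 !mul0r subrr.
have fd0 i : f (mderiv i h) = 0.
  have [->|->] := ord2P i; [move/eqP: d0 | move/eqP: d1];
  by rewrite mulf_eq0 mpolyC_eq0 (negPf jc0) orbF => /eqP.
case: n => [|n] in IH le *; first by apply/eqP; rewrite -msize_poly_eq0 -leqn0.
have z i : mderiv i h = 0 by apply: (IH _ _ (fd0 i)); apply: (@msize_mderiv_le i h n).
have hC := mderiv_eq0_const (z 0) (z 1).
by have := f_const h@_0%MM; rewrite -hC => e; apply: etrans (esym e) fh.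
Qed.

Local Notation A := (gen_subalg [tuple f x; f y]).
Local Notation B := (gen_subalg [tuple f x; f y; x + y]).

(** The abstract domain [S] is now K[x,y] itself, which f identifies with A. *)
Definition phi : R -> D := @iota K \o f.
HB.instance Definition _ := GRing.RMorphism.on phi.

Lemma phiD g h : phi (g + h) = phi g + phi h. Proof. by rewrite /phi /= rmorphD iotaD. Qed.
Lemma phiM g h : phi (g * h) = phi g * phi h. Proof. by rewrite /phi /= rmorphM iotaM. Qed.

Lemma phi_const c : phi (@mpolyC 2 K c) = c%:P%:P.
Proof. by rewrite /phi /= f_const iotaC. Qed.

Lemma phi_inj : injective phi.
Proof. by move=> g h /iota_inj /f_inj. Qed.

Lemma phi_jac : dw (phi x) * (phi y)^`() - (phi x)^`() * dw (phi y) = jc%:P%:P.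
Proof. by rewrite /phi /= -iota_jac jacf iotaC. Qed.

Let gcdR := @gcd_domain_mpoly2 K.

Lemma A_image z : A z <-> exists h, z = f h.
Proof. by split=> -[h ->]; exists h; rewrite f_comp. Qed.

Lemma B_image h : B (f h).
Proof.
elim/mpoly_alg_ind: h => [c|i|p q Hp Hq|p q Hp Hq].
- by rewrite f_const; apply: gen_subalgC.
- have [->|->] := ord2P i; [exact: (gen_subalgX [tuple f x; f y; x + y] 0) |
                            exact: (gen_subalgX [tuple f x; f y; x + y] 1)].
- by rewrite rmorphD; apply: gen_subalgD.
- by rewrite rmorphM; apply: gen_subalgM.
Qed.

Lemma B_memB z : B z <-> memB phi (iota z).
Proof.
split.
  move=> [h ->]; elim/mpoly_alg_ind: h => [c|i|p q Hp Hq|p q Hp Hq].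
  - by rewrite comp_mpolyC iotaC; apply: (memB_K phi_const).
  - rewrite comp_mpolyXU; case: i => [[|[|[|//]]] lt] /=; try exact: memB_phi.
    by rewrite iota_w; exists 'X; rewrite horX.
  - by rewrite comp_mpolyD iotaD; apply: memBD.
  - have -> : comp_mpoly [tuple f x; f y; x + y] (p * q) = comp_mpoly [tuple f x; f y; x + y] p
        * comp_mpoly [tuple f x; f y; x + y] q by rewrite rmorphM.
    by rewrite [iota _]iotaM; exact: memBM Hp Hq.
move=> [G E]; suff -> : z = (map_poly f G).[x + y].
  elim/poly_ind: G {E} => [|G c IH].
    by rewrite rmorph0 horner0 -mpolyC0; apply: gen_subalgC.
  rewrite rmorphD rmorphM /= map_polyX map_polyC hornerD hornerMX hornerC.
  apply/gen_subalgD/B_image; apply: gen_subalgM => //.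
  exact: (gen_subalgX [tuple f x; f y; x + y] 2).
apply: (@iota_inj K); rewrite E /hor -iota_w -horner_map; congr (_.[_]).
by apply/polyP => i; rewrite !coef_map.
Qed.

Let subB : subring_pred B := subring_gen_subalg _.

Definition unramified_at w0 y0 :=
  exists G, hor phi 'X%:P G = 0 /\ evp w0 y0 (hor phi 'X%:P G^`()) != 0.

Lemma unramified_bijective : (forall w0 y0, unramified_at w0 y0) -> bijective f.
Proof.
move=> unr; have [sw swE] := unramified_w hK gcdR phi_inj phi_const unr.
have [sy syE] := y_in_image hK gcdR phi_inj phi_const jc0 phi_jac (ex_intro _ sw swE).
have sur d : exists s, phi s = d.
  elim/poly_ind: d => [|d q [s IH]]; first by exists 0; rewrite rmorph0.
  have [t tE] : exists t, phi t = q%:P.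
    elim/poly_ind: q => [|q c [t IHt]]; first by exists 0; rewrite rmorph0.
    exists (t * sw + c%:MP); rewrite phiD phiM IHt swE.
    by rewrite phi_const -polyCM -polyCD.
  by exists (s * sy + t); rewrite phiD phiM IH syE tE.
have fsur z : exists s, f s = z.
  by have [s sE] := sur (iota z); exists s; apply: iota_inj.
have [g gE] := choice fsur.
by exists g => // s; apply: f_inj; rewrite gE.
Qed.

Definition ev_iota w0 y0 : R -> K := @evp K w0 y0 \o @iota K.
HB.instance Definition _ w0 y0 := GRing.RMorphism.on (ev_iota w0 y0).

Lemma y_fraction : exists a b, [/\ B a, B b, b != 0 & b * y = a].
Proof.
have [a [b [Ba Bb b0 E]]] := formanek hK phi_const jc0 phi_jac.
exists (jota a), (jota b); split; try by apply/B_memB; rewrite jotaK.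
  by apply: contraNneq b0 => z; rewrite -(jotaK b) z rmorph0.
by rewrite -E jotaM jota_y.
Qed.

Lemma locally_in_unramified w0 y0 : locally_in B (ev_iota w0 y0) y -> unramified_at w0 y0.
Proof.
move=> [s [/B_memB [C CE] s0 /B_memB [E EE]]].
apply: (local_unramified phi_const jc0 phi_jac); exists C, E; rewrite -CE -EE iotaM iotaX.
by split.
Qed.

Lemma normal_unramified w0 y0 : normal_ring B -> unramified_at w0 y0.
Proof.
move=> normB; have [a [b [Ba Bb b0 E]]] := y_fraction; apply: locally_in_unramified.
have rel s : (exists i, evp w0 y0 (fiber_poly (phi s))`_i != 0) ->
    locally_in B (ev_iota w0 y0) y.
  move=> [i nz]; apply: (normal_local subB normB Ba Bb b0 E (g := map_poly (@jota K) (fiber_poly (phi s)))).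
  - move=> j; apply: locally_in_incl => //; apply/B_memB; rewrite coef_map jotaK.
    exact: (fiber_poly_memB phi_const).
  - by rewrite -jota_y horner_map fiber_poly_root rmorph0.
  - by exists i; rewrite coef_map; move: nz; rewrite -{1}(jotaK (fiber_poly (phi s))`_i).
by have [/rel|/rel] := fiber_poly_nonvanishing jc0 phi_jac w0 y0.
Qed.

Lemma flat_unramified w0 y0 :
  flat_over B (fun a c : R => a * c) -> unramified_at w0 y0.
Proof.
move=> fl; have [a [b [Ba Bb b0 E]]] := y_fraction; apply: locally_in_unramified.
exact: flat_local Ba Bb b0 E fl.
Qed.

Lemma separable_unramified w0 y0 : separable_over A B -> unramified_at w0 y0.
Proof.
move=> sep; apply: contrapT => ram.
have {}ram G : hor phi 'X%:P G = 0 -> evp w0 y0 (hor phi 'X%:P G^`()) = 0.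
  by move=> G0; apply/eqP; apply: contraT => nz; case: ram; exists G.
have lift r : exists G, B r -> iota r = hor phi 'X%:P G.
  have [/B_memB [G GE]|nB] := pselect (B r); first by exists G.
  by exists 0 => Br; case: nB.
have [L LE] := choice lift.
pose del r := evp w0 y0 (hor phi 'X%:P (L r)^`()).
(* Independence of the chosen lift is exactly the assumed ramification. *)
have delE r G : iota r = hor phi 'X%:P G -> del r = evp w0 y0 (hor phi 'X%:P G^`()).
  move=> rG; have Br : B r by apply/B_memB; exists G.
  apply/eqP; rewrite -subr_eq0 -evpB -horN -horD -derivN -derivD; apply/eqP; apply: ram.
  by rewrite horD horN -rG -(LE r Br) subrr.
have AB r : A r -> B r by move=> /A_image [h ->]; apply: B_image.
have delw : del (x + y) = 1.
  rewrite (delE _ 'X); last by rewrite horX iota_w.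
  by rewrite derivX hor1 -[1 : D]/(1%:P%:P) evpC.
have delD r s : B r -> B s -> del (r + s) = del r + del s.
  move=> Br Bs; rewrite (delE _ (L r + L s)); first by rewrite derivD horD evpD.
  by rewrite horD iotaD (LE r Br) (LE s Bs).
have delM r s : B r -> B s -> del (r * s) = ev_iota w0 y0 r * del s + del r * ev_iota w0 y0 s.
  move=> Br Bs; rewrite (delE _ (L r * L s)); last by rewrite horM iotaM (LE r Br) (LE s Bs).
  by rewrite derivM horD !horM evpD !evpM /ev_iota /= (LE r Br) (LE s Bs) addrC.
have delA r : A r -> del r = 0.
  move=> /A_image [h ->]; rewrite (delE _ h%:P); last by rewrite horC.
  by rewrite derivC hor0 /evp /= /horner_eval !horner0.
have Bw : B (x + y) := gen_subalgX [tuple f x; f y; x + y] 2.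
have /eqP := separable_derivation subB AB sep delD delM delA Bw.
by rewrite delw oner_eq0.
Qed.

Lemma bijective_generates : bijective f -> (forall z, A z) /\ (forall z, B z).
Proof.
move=> [g fg gf]; have fz z : z = f (g z) by rewrite gf.
by split=> z; rewrite (fz z); [apply/A_image; exists (g z) | apply: B_image].
Qed.

End KellerMap.

Theorem theorem3p1 (K : closedFieldType) (hK : [pchar K] =i pred0)
  (f : {lrmorphism {mpoly K[2]} -> {mpoly K[2]}})
  (hjac : exists c : K, c != 0 /\ jac2 (f 'X_(0 : 'I_2)) (f 'X_(1 : 'I_2)) = c%:MP) :
  let P := f 'X_(0 : 'I_2) in
  let Q := f 'X_(1 : 'I_2) in
  let A := gen_subalg [tuple P; Q] in
  let B := gen_subalg [tuple P; Q; 'X_(0 : 'I_2) + 'X_(1 : 'I_2)] in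
  [/\ (normal_ring B <-> flat_over B (fun a c : {mpoly K[2]} => a * c)),
      (flat_over B (fun a c : {mpoly K[2]} => a * c) <-> separable_over A B)
    & (normal_ring B \/ flat_over B (fun a c : {mpoly K[2]} => a * c)
       \/ separable_over A B) -> bijective f].
Proof.
move: hjac => [jc [jc0 jacf]] P Q A B.
have unr_bij := unramified_bijective hK jc0 jacf.
have normal_bij : normal_ring B -> bijective f.
  by move=> h; apply: unr_bij => w0 y0; apply: (normal_unramified hK jc0 jacf).
have flat_bij : flat_over B (fun a c : {mpoly K[2]} => a * c) -> bijective f.
  by move=> h; apply: unr_bij => w0 y0; apply: (flat_unramified hK jc0 jacf).
have sep_bij : separable_over A B -> bijective f.
  by move=> h; apply: unr_bij => w0 y0; apply: separable_unramified.
have bij_normal : bijective f -> normal_ring B.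
  by case/bijective_generates => _ Ball; apply: gcd_domain_normal Ball (@gcd_domain_mpoly2 K).
have bij_flat : bijective f -> flat_over B (fun a c : {mpoly K[2]} => a * c).
  by case/bijective_generates => _ Ball; apply: flat_self.
have bij_sep : bijective f -> separable_over A B.
  by case/bijective_generates => Aall Ball; apply: separable_self.
split; [split=> h; auto | split=> h; auto | move=> [h|[h|h]]; auto].
Qed.
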